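(* Let $m\ge 0$, $q\ge 1$ be integers with $m+q\ge 2$, and let $\mathcal{B}$ be any right $\mathbb{D}C_{m,q}$-module. Then $$\mathrm{H}_0(C_{m,q},\mathcal{B})\cong \frac{\mathcal{B}(0)}{\mathcal{B}_{\mathrm S}(0)},$$ and, for any integer $r\geq 0$, $$\mathrm{H}_{2r+1}(C_{m,q},\mathcal{B})\cong \frac{\mathcal{B}^{\mathrm S}(r\cdot m)}{\mathcal{B}_{\mathrm T}((r\cdot m)\oplus 1)},\qquad \mathrm{H}_{2r+2}(C_{m,q},\mathcal{B})\cong \frac{\mathcal{B}^{\mathrm T}((r\cdot m)\oplus 1)}{\mathcal{B}_{\mathrm S}((r+1)\cdot m)}.$$
   Context: **Cyclic monoids.** $\mathbb{N}=\{0,1,\dots\}$. For $m\ge 0$, $q\ge 1$, the cyclic monoid $C_{m,q}$ of index $m$ and period $q$ is the set $\{0,1,\dots,m+q-1\}$ with addition $x\oplus y=\wp(x+y)$, where $\wp:\mathbb{N}\to C_{m,q}$ is given by $\wp(x)=x$ if $x<m+q$ and, for $x\ge m$, $\wp(x)$ is the unique element of $\{m,\dots,m+q-1\}$ congruent to $x$ modulo $q$. For $r\in\mathbb{N}$ and $x\in C_{m,q}$, $r\cdot x=x\oplus\cdots\oplus x$ ($r$ times) $=\wp(rx)$. It is assumed that $m+q\ge 2$. **The category $\mathbb{D}M$ and its modules.** For a monoid $M$ (written additively), $\mathbb{D}M$ is the category with object set $M$ and arrow set $M\times M\times M$, where $(x,y,z):y\to x+y+z$; composition is $(u,x+y+z,v)(x,y,z)=(u+x,y,z+v)$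 and the identity of $x$ is $(0,x,0)$. A left (resp. right) $\mathbb{D}M$-module is a functor $\mathbb{D}M\to\mathbf{Ab}$ (resp. $\mathbb{D}M^{op}\to\mathbf{Ab}$); morphisms are natural transformations. For a right module $\mathcal{B}$ write $x^*=\mathcal{B}(x,y,0):\mathcal{B}(x+y)\to\mathcal{B}(y)$ and $y_*=\mathcal{B}(0,x,y):\mathcal{B}(x+y)\to\mathcal{B}(x)$, so $\mathcal{B}(x,y,z)=x^*z_*=z_*x^*:\mathcal{B}(x+y+z)\to\mathcal{B}(y)$. **Leech homology.** For a right module $\mathcal{B}$ and a left module $\mathcal{A}$, $\mathcal{B}\otimes_{\mathbb{D}M}\mathcal{A}$ is the coend in $\mathbf{Ab}$ of $(x,y)\mapsto\mathcal{B}(x)\otimes\mathcal{A}(y)$. $\mathrm{H}_n(M,\mathcal{B})=\mathrm{Tor}_n^{\mathbb{D}M}(\mathcal{B},\mathbb{Z})$, i.e. the $n$-th left derived functor of $\mathcal{B}\otimes_{\mathbb{D}M}-$ evaluated at the constant left $\mathbb{D}M$-module $\mathbb{Z}$ (all maps identities). **The maps $\mathrm S$ and $\mathrm T$.** Let $\mathcal{B}$ be a right $\mathbb{D}C_{m,q}$-module. For $x\in C_{m,q}$, $\mathrm S:\mathcal{B}(x\oplus 1)\to\mathcal{B}(x)$ is $\mathrm S(b)=1_*b-1^*b$, where $1_*=\mathcal{B}(0,x,1)$ and $1^*=\mathcal{B}(1,x,0)$. For $x\in C_{m,q}$ with $x\ge 1$, the trace map $\mathrm T:\mathcal{B}(m\oplus(x-1))\to\mathcal{B}(x)$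 is $$\mathrm T(b)=\sum_{t=0}^{m+q-1}t^*(m+q-t-1)_*b-\sum_{t=0}^{m-1}t^*(m-t-1)_*b,$$ where $t^*(m+q-t-1)_*=\mathcal{B}(t,x,m+q-t-1)$ and $t^*(m-t-1)_*=\mathcal{B}(t,x,m-t-1)$. Put $\mathcal{B}^{\mathrm T}(x)=\{b\in\mathcal{B}(m\oplus(x-1))\mid\mathrm T(b)=0\}$, $\mathcal{B}_{\mathrm T}(x)=\{\mathrm T(b)\mid b\in\mathcal{B}(m\oplus(x-1))\}\subseteq\mathcal{B}(x)$, $\mathcal{B}^{\mathrm S}(x)=\{b\in\mathcal{B}(x\oplus 1)\mid\mathrm S(b)=0\}$, $\mathcal{B}_{\mathrm S}(x)=\{\mathrm S(b)\mid b\in\mathcal{B}(x\oplus 1)\}\subseteq\mathcal{B}(x)$. *)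

(* Defs.v *)
From HB Require Import structures.
From mathcomp Require Import all_boot all_order all_algebra.
From mathcomp Require Import boolp.
From mathcomp Require Import freeg.

Set Implicit Arguments.
Unset Strict Implicit.
Unset Printing Implicit Defensive.

Import GRing.Theory.
Local Open Scope ring_scope.
Local Open Scope quotient_scope.

Section Subgroups.
Variables (U V : zmodType) (f : {additive U -> V}).

Definition kerg : {pred U} := fun u => f u == 0.

Lemma kerg_closed : zmod_closed kerg.
Proof.
split=> [|u v]; rewrite !unfold_in ?raddf0 //.
by move=> /eqP fu /eqP fv; rewrite raddfB fu fv subr0.
Qed.

HB.instance Definition _ := GRing.isZmodClosed.Build U kerg kerg_closed.

Lemma kergE u : (u \in kerg) = (f u == 0).
Proof. by []. Qed.

Definition img : {pred V} := fun v => `[< exists u, f u = v >].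

Lemma img_closed : zmod_closed img.
Proof.
split=> [|u v]; first by apply/asboolP; exists 0; rewrite raddf0.
move=> /asboolP[x <-] /asboolP[y <-].
by apply/asboolP; exists (x - y); rewrite raddfB.
Qed.

HB.instance Definition _ := GRing.isZmodClosed.Build V img img_closed.

Definition preimg (W : zmodClosed V) : {pred U} := fun u => f u \in W.

Lemma preimg_closed W : zmod_closed (preimg W).
Proof.
split=> [|u v]; first by rewrite unfold_in raddf0 rpred0.
by move=> fu fv; rewrite unfold_in raddfB rpredB.
Qed.

HB.instance Definition _ W :=
  GRing.isZmodClosed.Build U (preimg W) (preimg_closed W).

End Subgroups.

Definition allg (U : zmodType) : {pred U} := fun=> true.

Lemma allg_closed (U : zmodType) : zmod_closed (@allg U).
Proof. by []. Qed.

HB.instance Definition _ (U : zmodType) :=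
  GRing.isZmodClosed.Build U (@allg U) (@allg_closed U).

Section SubgroupType.
Variables (V : zmodType) (U : zmodClosed V).

Record subg_of : Type := Subg { subg_val : V; _ : subg_val \in U }.

HB.instance Definition _ := [isSub for subg_val].
HB.instance Definition _ := [Choice of subg_of by <:].
HB.instance Definition _ := [SubChoice_isSubZmodule of subg_of by <:].

End SubgroupType.

(* U / I when I is included in U; U / (U :&: I) in general *)
Definition subquot (V : zmodType) (U I : zmodClosed V) : zmodType :=
  Quotient.quot (preimg (val : {additive subg_of U -> V}) I).

Definition isomorphic (U V : zmodType) : Prop :=
  exists f : {additive U -> V}, bijective f.

Definition transport_subg (I : Type) (V : I -> zmodType) (i j : I) (e : i = j)
    (U : zmodClosed (V i)) : zmodClosed (V j) :=
  ecast k (zmodClosed (V k)) e U.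

Section Span.
Variables (V : zmodType) (R : V -> Prop).

Definition spang : {pred V} := fun v =>
  `[< forall U : zmodClosed V, (forall r, R r -> r \in U) -> v \in U >].

Lemma spang_closed : zmod_closed spang.
Proof.
split=> [|u v]; first by apply/asboolP => U _; rewrite rpred0.
move=> /asboolP su /asboolP sv; apply/asboolP => U RU.
by rewrite rpredB ?su ?sv.
Qed.

HB.instance Definition _ := GRing.isZmodClosed.Build V spang spang_closed.

Lemma mem_spang r : R r -> r \in spang.
Proof. by move=> Rr; apply/asboolP => U; apply. Qed.

End Span.

Section FreeLift.
Variables (K : choiceType) (G : zmodType) (f : K -> G).

Definition free_lift (D : {freeg K}) : G := fglift (f : K -> zmodule G) D.

Lemma free_lift_is_zmod_morphism : zmod_morphism free_lift.
Proof. exact: (lift_is_additive (f : K -> zmodule G)). Qed.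

HB.instance Definition _ :=
  GRing.isZmodMorphism.Build {freeg K} G free_lift free_lift_is_zmod_morphism.

Lemma free_liftE k : free_lift << k >> = f k.
Proof. by rewrite /free_lift liftU scale1r. Qed.

End FreeLift.

Lemma free_ind (K : choiceType) (U : zmodClosed {freeg K}) :
  (forall k, << k >> \in U) -> forall D, D \in U.
Proof.
move=> genU D; rewrite -(freeg_sumE D); apply: rpred_sum => k _.
by rewrite -[coeff k D]intz -freegU_mulz rpredMz.
Qed.

Section FreeMap.
Variables (K L : choiceType) (f : K -> L).

Definition free_map : {additive {freeg K} -> {freeg L}} :=
  free_lift (fun k => << f k >>).

End FreeMap.

Section QuotientMaps.
Variables (V : zmodType) (I : zmodClosed V).
Local Notation Q := (Quotient.quot I).

Definition quot_proj (v : V) : Q := \pi_Q v.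

Lemma quot_proj_is_zmod_morphism : zmod_morphism quot_proj.
Proof. by move=> u v; rewrite /quot_proj raddfB. Qed.

HB.instance Definition _ :=
  GRing.isZmodMorphism.Build V Q quot_proj quot_proj_is_zmod_morphism.

Lemma quot_proj_eq0 v : (quot_proj v == 0) = (v \in I).
Proof. by rewrite -[v in RHS]subr0 Quotient.idealrBE -(raddf0 quot_proj). Qed.

Lemma quot_projK (x : Q) : quot_proj (repr x) = x.
Proof. exact: reprK. Qed.

Variables (G : zmodType) (f : {additive V -> G}).
Hypothesis fI : forall v, v \in I -> f v = 0.

Definition quot_lift (x : Q) : G := f (repr x).

Lemma quot_liftE v : quot_lift (quot_proj v) = f v.
Proof.
apply/eqP; rewrite -subr_eq0 -raddfB fI // -quot_proj_eq0.
by rewrite raddfB /= quot_projK subrr.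
Qed.

Lemma quot_lift_is_zmod_morphism : zmod_morphism quot_lift.
Proof.
move=> x y; rewrite -[x]quot_projK -[y]quot_projK -raddfB !quot_liftE.
exact: raddfB.
Qed.

End QuotientMaps.

Section Presentation.
Variables (K : choiceType) (R : {freeg K} -> Prop).

(* the abelian group with generators K and relators R *)
Definition pres : zmodType := Quotient.quot (spang R).

Definition gen (k : K) : pres := quot_proj (spang R) << k >>.

Lemma pres_ext (G : zmodType) (f g : {additive pres -> G}) :
  (forall k, f (gen k) = g (gen k)) -> f =1 g.
Proof.
move=> fg x; rewrite -[x](@quot_projK _ (spang R)).
pose h := (f \- g) \o quot_proj (spang R).
suff: repr x \in kerg h by rewrite kergE subr_eq0 => /eqP.
by apply: free_ind => k; rewrite kergE /= subr_eq0 fg.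
Qed.

Lemma pres_rel0 r : R r -> quot_proj (spang R) r = 0.
Proof. by move=> Rr; apply/eqP; rewrite quot_proj_eq0 mem_spang. Qed.

Variables (G : zmodType) (f : K -> G).
Hypothesis fR : forall r, R r -> free_lift f r = 0.

Lemma free_lift_span r : r \in spang R -> free_lift f r = 0.
Proof.
move=> /asboolP /(_ (kerg (free_lift f))) r0; apply/eqP/r0 => s Rs.
by rewrite kergE /= fR.
Qed.

Definition pres_lift : pres -> G := quot_lift (free_lift f).

Lemma pres_lift_is_zmod_morphism : zmod_morphism pres_lift.
Proof. exact: quot_lift_is_zmod_morphism free_lift_span. Qed.

Definition pres_liftA : {additive pres -> G} :=
  HB.pack pres_lift
    (GRing.isZmodMorphism.Build pres G pres_lift pres_lift_is_zmod_morphism).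

Lemma pres_liftE k : pres_liftA (gen k) = f k.
Proof.
exact: (etrans (quot_liftE free_lift_span _) (free_liftE _ _)).
Qed.

End Presentation.

Arguments pres_liftA : simpl never.

Record category := Category {
  ob : choiceType;
  hom : ob -> ob -> choiceType;
  idm : forall x, hom x x;
  compm : forall x y z, hom y z -> hom x y -> hom x z;
  comp1m : forall x y (f : hom x y), compm (idm y) f = f;
  compm1 : forall x y (f : hom x y), compm f (idm x) = f;
  compmA : forall x y z t (h : hom z t) (g : hom y z) (f : hom x y),
    compm h (compm g f) = compm (compm h g) f }.

Arguments hom {c} x y.
Arguments idm {c} x.
Arguments compm {c x y z} g f.

Definition op (C : category) : category :=
  @Category (ob C) (fun x y => hom y x) (@idm C)
    (fun x y z g f => compm f g)
    (fun x y f => compm1 f) (fun x y f => comp1m f)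
    (fun x y z t h g f => esym (compmA f g h)).

Section ProductCategory.
Variables C D : category.
Let prod_hom (p r : ob C * ob D) : choiceType := (hom p.1 r.1 * hom p.2 r.2)%type.

Definition prodc : category.
Proof.
refine (@Category (ob C * ob D)%type prod_hom (fun p => (idm p.1, idm p.2))
  (fun p r s g f => (compm g.1 f.1, compm g.2 f.2)) _ _ _).
- by move=> p r [f g] /=; rewrite !comp1m.
- by move=> p r [f g] /=; rewrite !compm1.
- by move=> p r s t f g h /=; rewrite !compmA.
Defined.

End ProductCategory.

Record functor (C : category) := Functor {
  fob :> ob C -> zmodType;
  fmap : forall x y, hom x y -> {additive fob x -> fob y};
  fmap1 : forall x (a : fob x), fmap (idm x) a = a;
  fmapM : forall x y z (g : hom y z) (f : hom x y) (a : fob x),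
    fmap (compm g f) a = fmap g (fmap f a) }.

Arguments fmap {C} _ {x y} _.

Record nattrans (C : category) (F G : functor C) := Nattrans {
  ntc :> forall x, {additive F x -> G x};
  ntN : forall x y (f : hom x y) (a : F x), ntc y (fmap F f a) = fmap G f (ntc x a) }.

Definition constF (C : category) (V : zmodType) : functor C :=
  @Functor C (fun=> V) (fun _ _ _ => idfun) (fun _ _ => erefl)
    (fun _ _ _ _ _ _ => erefl).

Definition surj (U V : Type) (f : U -> V) := forall v, exists u, f u = v.

Section Tensor.
Variables U V : zmodType.

Inductive tensor_rel : {freeg (U * V)%type} -> Prop :=
| TensorDl u u' v :
    tensor_rel (<< (u + u', v) >> - (<< (u, v) >> + << (u', v) >>))
| TensorDr u v v' :
    tensor_rel (<< (u, v + v') >> - (<< (u, v) >> + << (u, v') >>)).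

Definition tensor : zmodType := pres tensor_rel.

Definition pure (u : U) (v : V) : tensor := gen tensor_rel (u, v).

Lemma pureDl u u' v : pure (u + u') v = pure u v + pure u' v.
Proof.
by have /eqP := pres_rel0 (TensorDl u u' v); rewrite raddfB raddfD subr_eq0 => /eqP.
Qed.

Lemma pureDr u v v' : pure u (v + v') = pure u v + pure u v'.
Proof.
by have /eqP := pres_rel0 (TensorDr u v v'); rewrite raddfB raddfD subr_eq0 => /eqP.
Qed.

Variables (G : zmodType) (b : U -> V -> G).
Hypothesis bDl : forall u u' v, b (u + u') v = b u v + b u' v.
Hypothesis bDr : forall u v v', b u (v + v') = b u v + b u v'.

Lemma tensor_lift_subproof r :
  tensor_rel r -> free_lift (fun p => b p.1 p.2) r = 0.
Proof.
by case=> *; rewrite raddfB raddfD /= !free_liftE /= ?bDl ?bDr subrr.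
Qed.

Definition tensor_lift : {additive tensor -> G} :=
  pres_liftA tensor_lift_subproof.

Lemma tensor_liftE u v : tensor_lift (pure u v) = b u v.
Proof. exact: pres_liftE. Qed.

End Tensor.

Arguments tensor_lift : simpl never.

Section TensorMap.
Variables (U V U' V' : zmodType).
Variables (f : {additive U -> U'}) (g : {additive V -> V'}).

Let fg u v : tensor U' V' := pure (f u) (g v).

Let fgDl u u' v : fg (u + u') v = fg u v + fg u' v.
Proof. by rewrite /fg raddfD pureDl. Qed.

Let fgDr u v v' : fg u (v + v') = fg u v + fg u v'.
Proof. by rewrite /fg raddfD pureDr. Qed.

Definition tensor_map : {additive tensor U V -> tensor U' V'} :=
  tensor_lift fgDl fgDr.

Lemma tensor_mapE u v : tensor_map (pure u v) = pure (f u) (g v).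
Proof. exact: tensor_liftE. Qed.

End TensorMap.

Arguments tensor_map : simpl never.

Lemma tensor_ext (U V G : zmodType) (f g : {additive tensor U V -> G}) :
  (forall u v, f (pure u v) = g (pure u v)) -> f =1 g.
Proof. by move=> fg; apply: pres_ext => -[u v]; apply: fg. Qed.

Section Coend.
Variables (C : category) (T : functor (prodc (op C) C)).
Local Notation K := {x : ob C & T (x, x)}.
Local Notation inj x a := (Tagged (fun s => fob T (s, s)) (a : T (x, x)) : K).

Definition dmap (x y : ob C) (f : hom x y) : {additive T (y, x) -> T (x, x)} :=
  @fmap _ T (y, x) (x, x) (f, idm x).
Definition codmap (x y : ob C) (f : hom x y) : {additive T (y, x) -> T (y, y)} :=
  @fmap _ T (y, x) (y, y) (idm y, f).

(* The first kind of relators makes the group on the generators (x, a) the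
   direct sum of the T (x, x), the second one coequalises the two actions. *)
Inductive coend_rel : {freeg K} -> Prop :=
| CoendD (x : ob C) (a b : T (x, x)) :
    coend_rel (<< inj x (a + b) >> - (<< inj x a >> + << inj x b >>))
| CoendW (x y : ob C) (f : hom x y) (w : T (y, x)) :
    coend_rel (<< inj x (dmap f w) >> - << inj y (codmap f w) >>).

Definition coend : zmodType := pres coend_rel.

Definition coend_in (x : ob C) (a : T (x, x)) : coend := gen coend_rel (inj x a).

Lemma coend_in_is_zmod_morphism (x : ob C) : zmod_morphism (@coend_in x).
Proof.
have D a b : coend_in (a + b) = coend_in a + coend_in b.
  by have /eqP := pres_rel0 (CoendD a b); rewrite raddfB raddfD subr_eq0 => /eqP.
by move=> a b; apply/eqP; rewrite eq_sym subr_eq -D subrK.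
Qed.

HB.instance Definition _ (x : ob C) := GRing.isZmodMorphism.Build (T (x, x)) coend
  (@coend_in x) (@coend_in_is_zmod_morphism x).

Lemma coend_wedge (x y : ob C) (f : hom x y) w :
  coend_in (dmap f w) = coend_in (codmap f w).
Proof.
by have /eqP := pres_rel0 (CoendW f w); rewrite raddfB subr_eq0 => /eqP.
Qed.

Variables (G : zmodType) (b : forall x : ob C, {additive T (x, x) -> G}).
Hypothesis bW : forall (x y : ob C) (f : hom x y) w, b x (dmap f w) = b y (codmap f w).

Lemma coend_lift_subproof r :
  coend_rel r -> free_lift (fun k : K => b (tag k) (tagged k)) r = 0.
Proof.
case=> *; first by rewrite raddfB raddfD /= !free_liftE /= raddfD subrr.
by rewrite raddfB /= !free_liftE /= bW subrr.
Qed.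

Definition coend_lift : {additive coend -> G} := pres_liftA coend_lift_subproof.

Lemma coend_liftE (x : ob C) (a : T (x, x)) : coend_lift (coend_in a) = b x a.
Proof. exact: pres_liftE. Qed.

End Coend.

Arguments coend_lift : simpl never.

Section CoendMap.
Variables (C : category) (S T : functor (prodc (op C) C)) (h : nattrans S T).

Let hin (x : ob C) : {additive S (x, x) -> coend T} := @coend_in C T x \o h (x, x).

Let hinW (x y : ob C) (f : hom x y) (w : S (y, x)) :
  hin x (dmap S f w) = hin y (codmap S f w).
Proof. by rewrite /hin /= /dmap /codmap !ntN coend_wedge. Qed.

Definition coend_map : {additive coend S -> coend T} := coend_lift hinW.

Lemma coend_mapE (x : ob C) (a : S (x, x)) : coend_map (coend_in a) = coend_in (h (x, x) a).
Proof. exact: coend_liftE. Qed.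

End CoendMap.

Arguments coend_map : simpl never.

Section TensorOverC.
Variables (C : category) (B : functor (op C)).

Definition ext_tensor (A : functor C) : functor (prodc (op C) C).
Proof.
refine (@Functor (prodc (op C) C) (fun p => tensor (B p.1) (A p.2))
  (fun p r f => tensor_map (fmap B f.1) (fmap A f.2)) _ _).
- move=> p a; apply: (tensor_ext (g := idfun)) => u v.
  by apply: etrans (tensor_mapE _ _ u v) _; rewrite /= !fmap1.
- move=> p r s g f a.
  pose h1 := tensor_map (fmap B g.1) (fmap A g.2).
  pose h2 := tensor_map (fmap B f.1) (fmap A f.2).
  apply: (tensor_ext (g := h1 \o h2)) => u v.
  apply: etrans (tensor_mapE _ _ u v) _; rewrite /= !fmapM; apply: esym.
  exact: etrans (congr1 h1 (tensor_mapE _ _ u v)) (tensor_mapE _ _ _ _).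
Defined.

Definition ext_tensor_map (A A' : functor C) (h : nattrans A A') :
  nattrans (ext_tensor A) (ext_tensor A').
Proof.
refine (@Nattrans _ (ext_tensor A) (ext_tensor A')
  (fun p => tensor_map idfun (h p.2)) _).
move=> p r f a.
pose k : {additive _ -> _} := @tensor_map _ _ (B r.1) (A' r.2) idfun (h r.2).
pose k' : {additive _ -> _} := @tensor_map _ _ (B p.1) (A' p.2) idfun (h p.2).
apply: (tensor_ext (f := k \o fmap (ext_tensor A) f)
                   (g := fmap (ext_tensor A') f \o k')) => u v.
apply: etrans (congr1 k (tensor_mapE _ _ u v)) _.
apply: etrans (tensor_mapE _ _ _ _) _; apply: esym.
apply: etrans (congr1 (fmap (ext_tensor A') f) (tensor_mapE _ _ u v)) _.
by apply: etrans (tensor_mapE _ _ _ _) _; rewrite /= ntN.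
Defined.

Definition ctensor (A : functor C) : zmodType := coend (ext_tensor A).

Definition ctensor_map (A A' : functor C) (h : nattrans A A') :
    {additive ctensor A -> ctensor A'} :=
  coend_map (ext_tensor_map h).

End TensorOverC.

(* pointwise surjective = epimorphism in the category of functors *)
Definition projective (C : category) (P : functor C) : Prop :=
  forall (F G : functor C) (e : nattrans F G) (p : nattrans P G),
    (forall x, surj (e x)) ->
    exists l : nattrans P F, forall x a, e x (l x a) = p x a.

Record resolution (C : category) (A : functor C) := Resolution {
  res_ob :> nat -> functor C;
  res_d : forall n, nattrans (res_ob n.+1) (res_ob n);
  res_aug : nattrans (res_ob 0) A;
  res_proj : forall n, projective (res_ob n);
  res_aug_surj : forall x, surj (res_aug x);
  res_exact0 : forall x a, res_aug x a = 0 <-> exists b, res_d 0 x b = a;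
  res_exactS : forall n x a, res_d n x a = 0 <-> exists b, res_d n.+1 x b = a }.

Section StandardResolution.
Variable C : category.

Section Cover.
Variable A : functor C.
Local Notation K y := {x : ob C & (hom x y * A x)%type}.
Local Notation mk y x g a :=
  (Tagged (fun s => (hom s y * A s)%type) ((g, a) : hom x y * A x) : K y).

Let push y z (f : hom y z) (k : K y) : K z :=
  mk z (tag k) (compm f (tagged k).1) (tagged k).2.

(* the direct sum over x and a in A x of the free functors Z[hom x -] *)
Definition cover : functor C.
Proof.
refine (@Functor C (fun y => {freeg (K y)})
  (fun y z f => free_map (push f)) _ _).
- move=> y D.
  apply/eqP; rewrite -subr_eq0.
  pose h := free_map (push (idm y)) \- idfun.
  apply: (free_ind (U := kerg h)) => -[x [g a]].
  by rewrite kergE /= free_liftE /push /= comp1m subrr.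
- move=> y z t g f D; apply/eqP; rewrite -subr_eq0.
  pose h := free_map (push (compm g f)) \- (free_map (push g) \o free_map (push f)).
  apply: (free_ind (U := kerg h)) => -[x [k a]].
  by rewrite kergE /= !free_liftE /push /= compmA subrr.
Defined.

Definition cover_aug : nattrans cover A.
Proof.
refine (@Nattrans C cover A
  (fun y => free_lift (fun k : K y => fmap A (tagged k).1 (tagged k).2)) _).
move=> y z f D; apply/eqP; rewrite -subr_eq0.
pose h1 := free_lift (fun k : K z => fmap A (tagged k).1 (tagged k).2).
pose h2 := free_lift (fun k : K y => fmap A (tagged k).1 (tagged k).2).
pose h := h1 \o free_map (push f) \- (fmap A f \o h2).
apply: (free_ind (U := kerg h)) => -[x [k a]].
by rewrite kergE /= !free_liftE /push /= fmapM subrr.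
Defined.

Lemma cover_aug_surj y : surj (cover_aug y).
Proof.
move=> a; exists << mk y y (idm y) a >>.
by apply: etrans (free_liftE _ _) _; rewrite /= fmap1.
Qed.

Lemma cover_projective : projective cover.
Proof.
move=> F G e p esurj.
have lift x (a : A x) : {b : F x | e x b = p x << mk x x (idm x) a >>}.
  exact: cid (esurj x _).
pose l y (k : K y) := fmap F (tagged k).1 (sval (lift _ (tagged k).2)).
have lN y z (f : hom y z) (D : cover y) :
  free_lift (@l z) (fmap cover f D) = fmap F f (free_lift (@l y) D).
  apply/eqP; rewrite -subr_eq0.
  pose h := free_lift (@l z) \o fmap cover f \- (fmap F f \o free_lift (@l y)).
  apply: (free_ind (U := kerg h)) => -[x [k a]].
  by rewrite kergE /= !free_liftE /l /= fmapM subrr.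
exists (@Nattrans C cover F (fun y => free_lift (@l y)) lN) => y D.
apply/eqP; rewrite -subr_eq0.
pose h := e y \o free_lift (@l y) \- p y.
apply: (free_ind (U := kerg h)) => -[x [k a]].
rewrite kergE /= free_liftE /l /= ntN (svalP (lift x a)) -ntN.
by rewrite /= free_liftE /push /= compm1 subrr.
Qed.

End Cover.

Section Kernel.
Variables (F G : functor C) (h : nattrans F G).

Let kob x : zmodType := subg_of (kerg (h x)).

Let kfun_subproof x y (f : hom x y) (a : kob x) : fmap F f (val a) \in kerg (h y).
Proof.
rewrite kergE ntN; have := valP a; rewrite kergE => /eqP ->.
by rewrite raddf0.
Qed.

Let kfun x y (f : hom x y) (a : kob x) : kob y := Subg (kfun_subproof f a).

Let kfun_is_zmod_morphism x y (f : hom x y) : zmod_morphism (kfun f).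
Proof. by move=> a b; apply: val_inj; rewrite /= !raddfB. Qed.

Let kmap x y (f : hom x y) : {additive kob x -> kob y} :=
  HB.pack (kfun f) (GRing.isZmodMorphism.Build _ _ (kfun f) (kfun_is_zmod_morphism f)).

Definition kerF : functor C.
Proof.
refine (@Functor C kob kmap _ _).
- by move=> x a; apply: val_inj; rewrite /= fmap1.
- by move=> x y z g f a; apply: val_inj; rewrite /= fmapM.
Defined.

Definition kerF_in : nattrans kerF F :=
  @Nattrans C kerF F (fun x => (val : {additive kob x -> F x}))
    (fun _ _ _ _ => erefl).

End Kernel.

Definition nt_comp (F G H : functor C) (h : nattrans G H) (k : nattrans F G) :
  nattrans F H.
Proof.
refine (@Nattrans C F H (fun x => h x \o k x) _).
by move=> x y f a; rewrite /= !ntN.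
Defined.

Variable A : functor C.

Fixpoint syzygy (n : nat) : functor C :=
  if n is n'.+1 then kerF (cover_aug (syzygy n')) else A.

Let std_d n : nattrans (cover (syzygy n.+1)) (cover (syzygy n)) :=
  nt_comp (kerF_in (cover_aug (syzygy n))) (cover_aug (syzygy n.+1)).

Let std_exact n x (a : cover (syzygy n) x) :
  cover_aug (syzygy n) x a = 0 <-> exists b, std_d n x b = a.
Proof.
split=> [a0 | [b <-]]; last first.
  by apply/eqP; have := valP (cover_aug (syzygy n.+1) x b); rewrite kergE.
have ka : a \in kerg (cover_aug (syzygy n) x) by rewrite kergE a0.
have [b eb] := @cover_aug_surj (syzygy n.+1) x (Subg ka).
by exists b; rewrite /= eb.
Qed.

Let std_exactS n x (a : cover (syzygy n.+1) x) :
  std_d n x a = 0 <-> exists b, std_d n.+1 x b = a.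
Proof.
rewrite -std_exact; split=> [a0 | a0]; first exact: val_inj.
by rewrite [LHS](congr1 val a0).
Qed.

Definition std_resolution : resolution A :=
  @Resolution C A (fun n => cover (syzygy n)) std_d (cover_aug A)
    (fun n => @cover_projective (syzygy n)) (@cover_aug_surj A)
    (@std_exact 0) std_exactS.

End StandardResolution.

Section Homology.
Variables (X : nat -> zmodType) (d : forall n, {additive X n.+1 -> X n}).

Definition cycles (n : nat) : zmodClosed (X n) :=
  if n is n'.+1 return zmodClosed (X n) then kerg (d n') else @allg (X 0%N).

Definition homology (n : nat) : zmodType := subquot (cycles n) (img (d n)).

End Homology.

Definition Tor (C : category) (n : nat) (B : functor (op C)) (A : functor C) :
    zmodType :=
  homology (fun k => ctensor_map B (res_d (std_resolution A) k)) n.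

(* The construction makes sense for any monoid; it is set up here for
   commutative ones, so as to use the additive monoids of the library. *)
Section DM.
Variable M : nmodType.

(* (x, z) in dhom y t stands for the arrow (x, y, z) : y -> t = x + y + z *)
Definition dhom (y t : M) : choiceType := {p : M * M | p.1 + y + p.2 == t}.

Lemma did_subproof (x : M) : (0 : M) + x + 0 == x.
Proof. by rewrite add0r addr0. Qed.

Definition did (x : M) : dhom x x :=
  exist _ ((0 : M), (0 : M)) (did_subproof x).

Lemma dcomp_subproof (x y z : M) (g : dhom y z) (f : dhom x y) :
  (val g).1 + (val f).1 + x + ((val f).2 + (val g).2) == z.
Proof.
by case: f g => [[a b] /= /eqP <-] [[u v] /= /eqP <-]; rewrite !addrA.
Qed.

Definition dcomp (x y z : M) (g : dhom y z) (f : dhom x y) : dhom x z :=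
  exist _ ((val g).1 + (val f).1, (val f).2 + (val g).2) (dcomp_subproof g f).

Definition DM : category.
Proof.
refine (@Category M dhom did dcomp _ _ _).
- by move=> x y f; apply: val_inj => /=; rewrite add0r addr0; case: (val f).
- by move=> x y f; apply: val_inj => /=; rewrite addr0 add0r; case: (val f).
- by move=> x y z t h g f; apply: val_inj => /=; rewrite !addrA.
Defined.

Definition left_module : Type := functor DM.
Definition right_module : Type := functor (op DM).

(* B(x, y, z), as a map from B t for any t equal to x + y + z *)
Definition act (B : right_module) (x y z t : M) (e : x + y + z = t) :
    {additive B t -> B y} :=
  @fmap _ B t y (exist _ (x, z) (introT eqP e) : dhom y t).

Definition constZ : left_module := constF DM int.

Definition leech_homology (n : nat) (B : right_module) : zmodType :=
  Tor n B constZ.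

End DM.

Section Cyclic.
Variables (m q : nat).

(* index m, period q; hq is only there to provide the canonical addition *)
Definition cyclic (hq : (0 < q)%N) : Type := 'I_(m + q).

Hypothesis hq : (0 < q)%N.

(* the projection from the natural numbers *)
Definition wpn (x : nat) : nat := if (x < m + q)%N then x else (m + (x - m) %% q)%N.

Lemma wpn_lt x : (wpn x < m + q)%N.
Proof. by rewrite /wpn; case: ifP => // _; rewrite ltn_add2l ltn_pmod. Qed.

Definition wp (x : nat) : cyclic hq := Ordinal (wpn_lt x).

Lemma wpn_small x : (x < m + q)%N -> wpn x = x.
Proof. by rewrite /wpn => ->. Qed.

Lemma wpn_big x : (m <= x)%N -> wpn x = (m + (x - m) %% q)%N.
Proof.
rewrite /wpn => mx; case: ifP => // xmq.
by rewrite modn_small ?subnKC // ltn_subLR.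
Qed.

Lemma wpnDl x y : wpn (wpn x + y) = wpn (x + y).
Proof.
case: (ltnP x (m + q)) => [/wpn_small -> // | xmq].
have mx : (m <= x)%N by apply: leq_trans xmq; rewrite leq_addr.
rewrite (wpn_big mx) wpn_big; last by rewrite -addnA leq_addr.
rewrite wpn_big; last by rewrite (leq_trans mx) ?leq_addr.
by rewrite -addnA addKn modnDml addnBAC.
Qed.

Lemma wpnDr x y : wpn (x + wpn y) = wpn (x + y).
Proof. by rewrite addnC wpnDl addnC. Qed.

Definition cadd (x y : cyclic hq) : cyclic hq := wp (x + y).

Lemma caddA : associative cadd.
Proof. by move=> x y z; apply: val_inj; rewrite /= wpnDl wpnDr addnA. Qed.

Lemma caddC : commutative cadd.
Proof. by move=> x y; rewrite /cadd addnC. Qed.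

Lemma cadd0 : left_id (wp 0) cadd.
Proof.
by move=> x; apply: val_inj; rewrite /= wpnDl add0n wpn_small ?ltn_ord.
Qed.

HB.instance Definition _ := Choice.on (cyclic hq).
HB.instance Definition _ :=
  GRing.isNmodule.Build (cyclic hq) caddA caddC cadd0.

Lemma wpD x y : wp (x + y) = wp x + wp y.
Proof. by apply: val_inj; rewrite /= wpnDl wpnDr. Qed.

Lemma wpM x r : wp (r * x) = wp x *+ r.
Proof. by elim: r => [|r IHr] //; rewrite mulSn mulrS wpD IHr. Qed.

Lemma wp_val (x : cyclic hq) : wp x = x.
Proof. by apply: val_inj; rewrite /= wpn_small ?ltn_ord. Qed.

Lemma wp_period x : (m <= x)%N -> wp (x + q) = wp x.
Proof.
move=> mx; apply: val_inj; rewrite /= !wpn_big ?(leq_trans mx) ?leq_addr //.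
by rewrite -addnBAC // modnDr.
Qed.

Lemma wp_periodM x k : (m <= x)%N -> wp (x + k * q) = wp x.
Proof.
move=> mx; elim: k => [|k IHk]; first by rewrite addn0.
by rewrite mulSn addnCA addnC wp_period ?(leq_trans mx) ?leq_addr.
Qed.

End Cyclic.

Arguments wp {m q} hq x.

Section SandT.
Variables (m q : nat) (hq : (0 < q)%N).
Local Notation C := (cyclic m hq).
Local Notation w := (@wp m q hq).
Variable B : right_module C.

Lemma S_lower_eq (x : C) : 0 + x + w 1 = x + w 1.
Proof. by rewrite add0r. Qed.

Lemma S_upper_eq (x : C) : w 1 + x + 0 = x + w 1.
Proof. by rewrite addr0 addrC. Qed.

Definition Smap (x : C) (b : B (x + w 1)) : B x :=
  act B (S_lower_eq x) b - act B (S_upper_eq x) b.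

Lemma Smap_is_zmod_morphism x : zmod_morphism (@Smap x).
Proof. by move=> a b; rewrite /Smap !raddfB addrACA. Qed.

HB.instance Definition _ x :=
  GRing.isZmodMorphism.Build (B (x + w 1)) (B x) (@Smap x)
    (@Smap_is_zmod_morphism x).

(* x - 1 for x >= 1 *)
Definition cpred (x : C) : C := w x.-1.

Section Trace.
Variables (x : C) (hx : (0 < x)%N).

Lemma T_eq (n t : nat) : (t < n)%N -> w n = w m ->
  w t + x + w (n - t - 1) = w m + cpred x.
Proof.
move=> tn <-; rewrite -[in LHS](wp_val x) -!wpD; congr wp.
have e : (t + (n - t - 1)).+1 = n.
  by rewrite -addnS subn1 prednK ?subn_gt0 // subnKC // ltnW.
by rewrite addnAC -[in RHS]e addSnnS prednK.
Qed.

Lemma T_eq_mq (t : 'I_(m + q)) :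
  w t + x + w (m + q - t - 1) = w m + cpred x.
Proof. by apply: T_eq => //; rewrite wp_period. Qed.

Lemma T_eq_m (t : 'I_m) : w t + x + w (m - t - 1) = w m + cpred x.
Proof. exact: T_eq. Qed.

Definition Tmap (b : B (w m + cpred x)) : B x :=
  \sum_(t < m + q) act B (T_eq_mq t) b - \sum_(t < m) act B (T_eq_m t) b.

Lemma Tmap_is_zmod_morphism : zmod_morphism Tmap.
Proof.
move=> a b; rewrite /Tmap.
under eq_bigr do rewrite raddfB.
under [X in _ - X = _]eq_bigr do rewrite raddfB.
by rewrite !sumrB opprD addrACA -opprD.
Qed.

HB.instance Definition _ :=
  GRing.isZmodMorphism.Build (B (w m + cpred x)) (B x) Tmap
    Tmap_is_zmod_morphism.

Definition kerT : zmodClosed (B (w m + cpred x)) := kerg Tmap.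
Definition imT : zmodClosed (B x) := img Tmap.

End Trace.

Definition kerS (x : C) : zmodClosed (B (x + w 1)) := kerg (@Smap x).
Definition imS (x : C) : zmodClosed (B x) := img (@Smap x).

End SandT.

Section Degrees.
Variables (m q : nat) (hq : (0 < q)%N).
Local Notation w := (@wp m q hq).

Lemma mulm_succ_gt0 (r : nat) : (2 <= m + q)%N -> (0 < (w m *+ r + w 1)%R)%N.
Proof.
move=> mq; rewrite -wpM -wpD /= /wpn; case: (ltnP (r * m + 1) (m + q)) => [_ | ].
  by rewrite addn1.
case: (posnP m) => [m0 | m0 _]; last by rewrite addn_gt0 m0.
by move: mq; rewrite m0 muln0 !add0n ltnNge => /negPf->.
Qed.

(* kerT at x = r.m + 1 lives in B (m + (x - 1)), which is B ((r + 1).m) *)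
Lemma mulm_succ_pred (r : nat) :
  w m *+ r.+1 = w m + cpred (w m *+ r + w 1).
Proof.
rewrite mulrS -wpM -wpD -[in RHS]wpD /cpred -wpD /=.
case: (posnP m) => [m0 | m0].
  apply: val_inj; rewrite m0 !muln0 /= !add0n /wpn add0n.
  by case: (q) hq => [|[|p]].
rewrite addn1; case: (ltnP (r * m).+1 (m + q)) => [lt | le].
  by rewrite wpn_small.
have mr : (m <= (r * m).+1)%N by apply: leq_trans le; rewrite leq_addr.
rewrite wpn_big //; set y := ((r * m).+1 - m)%N.
have -> : (r * m = (m + y %% q).-1 + y %/ q * q)%N.
  apply: succn_inj; rewrite -addSn prednK ?addn_gt0 ?m0 // -addnA.
  by rewrite [(_ + y %/ q * q)%N]addnC -divn_eq subnKC.
by rewrite addnA wp_periodM ?leq_addr.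
Qed.

End Degrees.

Arguments mulm_succ_gt0 {m q} hq r.
Arguments mulm_succ_pred {m q} hq r.

(* Main.v *)
(* The right module B is tensored with a periodic resolution of the constant
   module Z by representable functors, instead of the standard one; the
   comparison theorem for projective resolutions makes this harmless, and
   B (x) Z[hom(x, -)] = B x.

   Write R = Z[t] / (t^(m+q) - t^m) for the monoid ring. The values at y of the
   functor represented by x, summed over all y, form R (x) R, the arrow
   (u, x, v) being the monomial a^u b^v. With f(t) = t^(m+q) - t^m, the maps
   S and T come from multiplication by b - a and by (f(b) - f(a)) / (b - a),
   so the resolution is the classical two-periodic bimodule resolution of
   Z[t] / (f), cut into its graded pieces. As R-modules (R acting through a),
   its terms are free on 1, b, ..., b^(m+q-1), and
     sigma (b^v) = (b^v - a^v) / (b - a),   tau (b^v) = 1 if v = m + q - 1, else 0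
   give a contracting homotopy. *)
From HB Require Import structures.
From mathcomp Require Import all_boot all_order all_algebra.
From mathcomp Require Import boolp zify.
From mathcomp Require Import freeg.
Require Import Defs.

Set Implicit Arguments.
Unset Strict Implicit.
Unset Printing Implicit Defensive.

Import GRing.Theory.
Local Open Scope ring_scope.

Lemma isomorphic_trans (U V W : zmodType) :
  isomorphic U V -> isomorphic V W -> isomorphic U W.
Proof. by move=> [f fb] [g gb]; exists (g \o f); apply: bij_comp. Qed.

(** * Isomorphisms of subquotients and of homology *)

Section QuotientIso.
Variables (V V' : zmodType) (I : zmodClosed V) (I' : zmodClosed V').
Variables (f : {additive V -> V'}) (g : {additive V' -> V}).

Lemma quot_iso :
  (forall v, v \in I -> f v \in I') -> (forall v, v \in I' -> g v \in I) ->
  (forall v, g (f v) - v \in I) -> (forall v, f (g v) - v \in I') ->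
  isomorphic (Quotient.quot I) (Quotient.quot I').
Proof.
move=> fI gI gf fg.
have f0 v : v \in I -> (quot_proj I' \o f) v = 0.
  by move=> Iv; apply/eqP; rewrite /= quot_proj_eq0 fI.
have g0 v : v \in I' -> (quot_proj I \o g) v = 0.
  by move=> Iv; apply/eqP; rewrite /= quot_proj_eq0 gI.
pose F : {additive _ -> _} := HB.pack (quot_lift (quot_proj I' \o f))
  (GRing.isZmodMorphism.Build _ _ _ (quot_lift_is_zmod_morphism f0)).
have FE v : F (quot_proj I v) = quot_proj I' (f v) by exact: (quot_liftE f0 v).
exists F; exists (quot_lift (quot_proj I \o g)) => x.
  rewrite -[x]quot_projK FE (quot_liftE g0) /=; apply/eqP.
  by rewrite -subr_eq0 -raddfB quot_proj_eq0.
rewrite -[x]quot_projK (quot_liftE g0) FE; apply/eqP.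
by rewrite -subr_eq0 -raddfB quot_proj_eq0.
Qed.

End QuotientIso.

Lemma subg_restrict (V V' : zmodType) (Z : zmodClosed V) (Z' : zmodClosed V')
    (f : {additive V -> V'}) :
  (forall v, v \in Z -> f v \in Z') ->
  {F : {additive subg_of Z -> subg_of Z'} | forall v, val (F v) = f (val v)}.
Proof.
move=> fZ; pose F (v : subg_of Z) := Subg (fZ _ (valP v)).
have FB : zmod_morphism F by move=> u v; apply: val_inj; rewrite /= !raddfB.
pose FA : {additive _ -> _} := HB.pack F (GRing.isZmodMorphism.Build _ _ F FB).
by exists FA.
Qed.

Lemma preimgE (V V' : zmodType) (f : {additive V -> V'}) (W : zmodClosed V') v :
  (v \in preimg f W) = (f v \in W).
Proof. by []. Qed.

(** The composites need to be identities only on [Z] and [Z'], and only modulo [I] and [I']. This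
    serves chain homotopy equivalences as well as genuine isomorphisms. *)
Lemma subquot_iso (V V' : zmodType) (Z I : zmodClosed V) (Z' I' : zmodClosed V')
    (f : {additive V -> V'}) (g : {additive V' -> V}) :
  (forall v, v \in Z -> f v \in Z') -> (forall v, v \in Z' -> g v \in Z) ->
  (forall v, v \in I -> f v \in I') -> (forall v, v \in I' -> g v \in I) ->
  (forall v, v \in Z -> g (f v) - v \in I) ->
  (forall v, v \in Z' -> f (g v) - v \in I') ->
  isomorphic (subquot Z I) (subquot Z' I').
Proof.
move=> fZ gZ fI gI gf fg.
have [F FE] := subg_restrict fZ; have [G GE] := subg_restrict gZ.
apply: (quot_iso (f := F) (g := G)) => v; rewrite !preimgE.
- by rewrite /= FE; apply: fI.
- by rewrite /= GE; apply: gI.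
- by rewrite raddfB /= GE FE gf // (valP v).
- by rewrite raddfB /= FE GE fg // (valP v).
Qed.

Lemma imgP (U V : zmodType) (f : {additive U -> V}) v :
  reflect (exists u, f u = v) (v \in img f).
Proof. exact: asboolP. Qed.

Section HomologyIso.
Variables (X Y : nat -> zmodType).
Variables (dX : forall n, {additive X n.+1 -> X n}).
Variables (dY : forall n, {additive Y n.+1 -> Y n}).

Definition chain_map (f : forall n, {additive X n -> Y n}) : Prop :=
  forall n x, dY n (f n.+1 x) = f n (dX n x).

Lemma chain_map_cycles f n x :
  chain_map f -> x \in cycles dX n -> f n x \in cycles dY n.
Proof.
by case: n x => // n x fd; rewrite !kergE fd => /eqP ->; rewrite raddf0.
Qed.

Lemma chain_map_img f n x :
  chain_map f -> x \in img (dX n) -> f n x \in img (dY n).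
Proof. by move=> fd /imgP[y <-]; apply/imgP; exists (f n.+1 y). Qed.

End HomologyIso.

(** A chain homotopy [s] between the identity and [h]. Degree 0 is separate because no differential
    leaves it. *)
Definition contracts (X : nat -> zmodType) (d : forall n, {additive X n.+1 -> X n})
    (h : forall n, X n -> X n) (s : forall n, {additive X n -> X n.+1}) : Prop :=
  (forall x, h 0%N x - x = d 0%N (s 0%N x)) /\
  (forall n x, h n.+1 x - x = d n.+1 (s n.+1 x) + s n (d n x)).

Lemma contracts_img (X : nat -> zmodType) (d : forall n, {additive X n.+1 -> X n})
    h s n x :
  contracts d h s -> x \in cycles d n -> h n x - x \in img (d n).
Proof.
move=> [h0 hS]; case: n x => [|n] x.
  by move=> _; rewrite h0; apply/imgP; exists (s 0%N x).
rewrite kergE hS => /eqP ->; rewrite raddf0 addr0.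
by apply/imgP; exists (s n.+1 x).
Qed.

Lemma homology_iso (X Y : nat -> zmodType)
    (dX : forall n, {additive X n.+1 -> X n})
    (dY : forall n, {additive Y n.+1 -> Y n})
    (f : forall n, {additive X n -> Y n}) (g : forall n, {additive Y n -> X n}) s t :
  chain_map dX dY f -> chain_map dY dX g ->
  contracts dX (fun n => g n \o f n) s -> contracts dY (fun n => f n \o g n) t ->
  forall n, isomorphic (homology dX n) (homology dY n).
Proof.
move=> fd gd hs ht n; apply: (subquot_iso (f := f n) (g := g n)) => v.
- exact: chain_map_cycles.
- exact: chain_map_cycles.
- exact: chain_map_img.
- exact: chain_map_img.
- exact: (contracts_img hs).
- exact: (contracts_img ht).
Qed.

(** * Comparison of projective resolutions *)

Section Naturality.
Variable C : category.
Implicit Types F G H : functor C.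

Definition nt_id F : nattrans F F :=
  @Nattrans C F F (fun=> idfun) (fun _ _ _ _ => erefl).

Lemma nt_sub_subproof F G (h k : nattrans F G) x y (f : hom x y) a :
  (h y \- k y) (fmap F f a) = fmap G f ((h x \- k x) a).
Proof. by rewrite /= !ntN raddfB. Qed.

Definition nt_sub F G (h k : nattrans F G) : nattrans F G :=
  Nattrans (nt_sub_subproof h k).

Lemma ker_lift F G H (d : nattrans G H) (h : nattrans F G) :
  (forall x a, d x (h x a) = 0) ->
  exists k : nattrans F (kerF d), forall x a, kerF_in d x (k x a) = h x a.
Proof.
move=> dh0.
have kh x a : h x a \in kerg (d x) by rewrite kergE dh0.
pose k x a : kerF d x := Subg (kh x a).
have kB x : zmod_morphism (k x) by move=> a b; apply: val_inj; rewrite /= raddfB.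
pose K x : {additive F x -> kerF d x} :=
  HB.pack (k x) (GRing.isZmodMorphism.Build _ _ (k x) (kB x)).
have KN x y (f : hom x y) (a : F x) : K y (fmap F f a) = fmap (kerF d) f (K x a).
  by apply: val_inj; rewrite /= ntN.
by exists (Nattrans KN).
Qed.

(** Exactness at [G] makes [d'] a pointwise surjection onto the kernel functor of [d]. Since [h]
    lands in that kernel, projectivity of [P] lifts it. *)
Lemma projective_lift P F G H (d' : nattrans F G) (d : nattrans G H)
    (h : nattrans P G) :
  projective P -> (forall x a, d x a = 0 <-> exists b, d' x b = a) ->
  (forall x a, d x (h x a) = 0) ->
  exists k : nattrans P F, forall x a, d' x (k x a) = h x a.
Proof.
move=> projP ex dh0; have [h1 h1E] := ker_lift dh0.
have dd0 x a : d x (d' x a) = 0 by apply/ex; exists a.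
have [e eE] := ker_lift dd0.
have esurj x : surj (e x).
  move=> v; have [b bE] := (ex x (val v)).1 (eqP (valP v)).
  by exists b; apply: val_inj; rewrite -bE -eE.
have [k kE] := projP _ _ e h1 esurj.
by exists k => x a; rewrite -eE kE h1E.
Qed.

End Naturality.

(** Dependent choice in varying types. The recursion carries two consecutive terms together with a
    proof that they are related, since a term can be extended only when it is already related to its
    predecessor. *)
Lemma dependent_seq (T : nat -> Type) (R : forall n, T n -> T n.+1 -> Prop)
    (t0 : T 0%N) (t1 : T 1%N) :
  R 0%N t0 t1 ->
  (forall n t t', R n t t' -> exists t'', R n.+1 t' t'') ->
  exists s : forall n, T n, s 0%N = t0 /\ forall n, R n (s n) (s n.+1).
Proof.
move=> R01 Rstep.
pose U n := {p : T n * T n.+1 | R n p.1 p.2}.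
pose next n (u : U n) : U n.+1 :=
  let t := cid (Rstep n _ _ (svalP u)) in exist _ ((sval u).2, sval t) (svalP t).
pose fix u n : U n :=
  if n is n'.+1 then next n' (u n') else exist _ (t0, t1) R01.
exists (fun n => (sval (u n)).1); split=> // n.
exact: (svalP (u n)).
Qed.

Section Comparison.
Variables (C : category) (A : functor C).

(** Chain maps of resolutions lifting the identity of [A]. *)
Definition over_id (P Q : resolution A) (f : forall n, nattrans (P n) (Q n)) : Prop :=
  (forall x a, res_aug Q x (f 0%N x a) = res_aug P x a) /\
  (forall n x a, res_d Q n x (f n.+1 x a) = f n x (res_d P n x a)).

Lemma res_dd (P : resolution A) n x a : res_d P n x (res_d P n.+1 x a) = 0.
Proof. by apply/res_exactS; exists a. Qed.

Lemma res_aug_d (P : resolution A) x a : res_aug P x (res_d P 0 x a) = 0.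
Proof. by apply/res_exact0; exists a. Qed.

Lemma over_id_exists (P Q : resolution A) :
  exists f : forall n, nattrans (P n) (Q n), over_id f.
Proof.
have [f0 f0E] := @res_proj _ _ P 0%N _ _ (res_aug Q) (res_aug P) (@res_aug_surj _ _ Q).
pose R n (f : nattrans (P n) (Q n)) (f' : nattrans (P n.+1) (Q n.+1)) :=
  forall x a, res_d Q n x (f' x a) = f x (res_d P n x a).
have [f1 f1E] : exists f1, R 0%N f0 f1.
  apply: (projective_lift (h := nt_comp f0 (res_d P 0)) (@res_proj _ _ P 1)
    (@res_exact0 _ _ Q)) => x a.
  by rewrite /= f0E res_aug_d.
have [n f f' Rff'|f [fE0 fE]] := dependent_seq f1E.
  apply: (projective_lift (h := nt_comp f' (res_d P n.+1)) (@res_proj _ _ P n.+2)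
    (@res_exactS _ _ Q n)) => x a.
  by rewrite /= Rff' res_dd raddf0.
by exists f; split=> //; rewrite fE0.
Qed.

(** Uniqueness half of the comparison theorem. The next homotopy lifts h - id - s d, which the
    differential kills by the homotopy identity one degree lower. *)
Lemma over_id_contracts (P : resolution A) (h : forall n, nattrans (P n) (P n)) :
  over_id h ->
  exists s : forall n, nattrans (P n) (P n.+1),
    (forall x a, h 0%N x a - a = res_d P 0 x (s 0%N x a)) /\
    (forall n x a, h n.+1 x a - a =
      res_d P n.+1 x (s n.+1 x a) + s n x (res_d P n x a)).
Proof.
move=> [haug hd].
have [s0 s0E] : exists s0 : nattrans (P 0%N) (P 1%N),
    forall x a, res_d P 0 x (s0 x a) = nt_sub (h 0%N) (nt_id _) x a.
  apply: (projective_lift (@res_proj _ _ P 0) (@res_exact0 _ _ P)) => x a.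
  by rewrite raddfB /= haug subrr.
pose R n (s : nattrans (P n) (P n.+1)) (s' : nattrans (P n.+1) (P n.+2)) :=
  forall x a, res_d P n.+1 x (s' x a) = h n.+1 x a - a - s x (res_d P n x a).
pose rhs n s := nt_sub (nt_sub (h n.+1) (nt_id _)) (nt_comp s (res_d P n)).
have [s1 s1E] : exists s1, R 0%N s0 s1.
  apply: (projective_lift (h := rhs 0%N s0) (@res_proj _ _ P 1)
    (@res_exactS _ _ P 0)) => x a.
  by rewrite /= !raddfB /= hd s0E /= subrr.
have [n s s' Rss'|s [sE0 sE]] := dependent_seq s1E.
  apply: (projective_lift (h := rhs n.+1 s') (@res_proj _ _ P n.+2)
    (@res_exactS _ _ P n.+1)) => x a.
  by rewrite /= !raddfB /= hd Rss' res_dd raddf0 subr0 subrr.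
exists s; split=> [x a|n x a]; first by rewrite sE0 s0E.
by rewrite sE subrK.
Qed.

End Comparison.

(** * Tensoring over a category: independence of the resolution *)

Section TensorOver.
Variables (C : category) (B : functor (op C)).

Definition ct_pure (A : functor C) (x : ob C) (b : B x) (a : A x) : ctensor B A :=
  @coend_in C (ext_tensor B A) x (pure b a).

Lemma ct_pureDl (A : functor C) (x : ob C) (b b' : B x) (a : A x) :
  ct_pure (b + b') a = ct_pure b a + ct_pure b' a.
Proof. by rewrite /ct_pure pureDl raddfD. Qed.

Lemma ct_pure_is_zmod_morphism (A : functor C) (x : ob C) (b : B x) :
  zmod_morphism (@ct_pure A x b).
Proof.
move=> a a'; apply/eqP; rewrite eq_sym subr_eq.
by rewrite /ct_pure -raddfD -pureDr subrK.
Qed.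

HB.instance Definition _ (A : functor C) (x : ob C) (b : B x) :=
  GRing.isZmodMorphism.Build (A x) (ctensor B A) (@ct_pure A x b)
    (@ct_pure_is_zmod_morphism A x b).

Lemma ct_ext (A : functor C) (G : zmodType) (f g : {additive ctensor B A -> G}) :
  (forall (x : ob C) (b : B x) (a : A x), f (ct_pure b a) = g (ct_pure b a)) -> f =1 g.
Proof.
move=> fg; apply: pres_ext => -[x u].
pose i : {additive _ -> _} := @coend_in C (ext_tensor B A) x.
by apply: (tensor_ext (f := f \o i) (g := g \o i)) => b a; apply: fg.
Qed.

Lemma ct_mapE (A A' : functor C) (h : nattrans A A') (x : ob C) (b : B x) (a : A x) :
  ctensor_map B h (ct_pure b a) = ct_pure b (h x a).
Proof.
apply: etrans (coend_mapE _ _) _; congr coend_in.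
exact: tensor_mapE.
Qed.

Lemma ct_wedge (A : functor C) (x y : ob C) (f : hom x y) (b : B y) (a : A x) :
  ct_pure (fmap B f b) a = ct_pure b (fmap A f a).
Proof.
have dE : dmap (ext_tensor B A) f (pure b a) = pure (fmap B f b) a.
  by apply: etrans (tensor_mapE _ _ _ _) _; congr pure; apply: fmap1.
have codE : codmap (ext_tensor B A) f (pure b a) = pure b (fmap A f a).
  by apply: etrans (tensor_mapE _ _ _ _) _; congr pure; apply: (@fmap1 _ B).
rewrite /ct_pure -dE -codE; exact: coend_wedge.
Qed.

Definition tensor_homology (A : functor C) (P : resolution A) n : zmodType :=
  homology (fun k => ctensor_map B (res_d P k)) n.

(** Tensoring with [B] is additive, so it carries the comparison maps and their homotopies to a
    chain homotopy equivalence. All identities are checked on pure tensors. *)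
Lemma tensor_homology_iso (A : functor C) (P Q : resolution A) n :
  isomorphic (tensor_homology P n) (tensor_homology Q n).
Proof.
have [f fid] := over_id_exists P Q; have [g gid] := over_id_exists Q P.
have comp_id (P' Q' : resolution A) (f' : forall k, nattrans (P' k) (Q' k))
    (g' : forall k, nattrans (Q' k) (P' k)) :
    over_id f' -> over_id g' -> over_id (fun k => nt_comp (g' k) (f' k)).
  by move=> [f0 fd] [g0 gd]; split=> * /=; rewrite ?g0 ?gd ?f0 ?fd.
have [s [s0 sS]] := over_id_contracts (comp_id _ _ _ _ fid gid).
have [t [t0 tS]] := over_id_contracts (comp_id _ _ _ _ gid fid).
have mapM (P' Q' : resolution A) (f' : forall k, nattrans (P' k) (Q' k)) :
    over_id f' ->
    chain_map (fun k => ctensor_map B (res_d P' k)) (fun k => ctensor_map B (res_d Q' k))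
      (fun k => ctensor_map B (f' k)).
  move=> [_ fd] k; pose d' := ctensor_map B (res_d P' k).
  pose d := ctensor_map B (res_d Q' k).
  have dE x (b : B x) (a : P' k.+1 x) : d (ctensor_map B (f' k.+1) (ct_pure b a)) =
      ctensor_map B (f' k) (d' (ct_pure b a)).
    by rewrite !ct_mapE fd.
  exact: (ct_ext (f := d \o ctensor_map B (f' k.+1)) (g := ctensor_map B (f' k) \o d')).
have mapC (P' Q' : resolution A) (f' : forall k, nattrans (P' k) (Q' k))
    (g' : forall k, nattrans (Q' k) (P' k))
    (s' : forall k, nattrans (P' k) (P' k.+1)) :
    (forall x a, g' 0%N x (f' 0%N x a) - a = res_d P' 0 x (s' 0%N x a)) ->
    (forall k x a, g' k.+1 x (f' k.+1 x a) - a =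
      res_d P' k.+1 x (s' k.+1 x a) + s' k x (res_d P' k x a)) ->
    contracts (fun k => ctensor_map B (res_d P' k))
      (fun k => ctensor_map B (g' k) \o ctensor_map B (f' k))
      (fun k => ctensor_map B (s' k)).
  move=> h0 hS; pose d k := ctensor_map B (res_d P' k).
  pose gf k := ctensor_map B (g' k) \o ctensor_map B (f' k).
  have gfE k x (b : B x) (a : P' k x) : gf k (ct_pure b a) = ct_pure b (g' k x (f' k x a)).
    by rewrite -!ct_mapE.
  split=> [|k].
    have E x (b : B x) (a : P' 0%N x) : gf 0%N (ct_pure b a) - ct_pure b a =
        d 0%N (ctensor_map B (s' 0%N) (ct_pure b a)).
      by rewrite gfE !ct_mapE -raddfB h0.
    exact: (ct_ext (f := gf 0%N \- idfun) (g := d 0%N \o ctensor_map B (s' 0%N))).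
  have E x (b : B x) (a : P' k.+1 x) : gf k.+1 (ct_pure b a) - ct_pure b a =
      d k.+1 (ctensor_map B (s' k.+1) (ct_pure b a)) +
      ctensor_map B (s' k) (d k (ct_pure b a)).
    by rewrite gfE !ct_mapE -raddfB hS raddfD.
  exact: (ct_ext (f := gf k.+1 \- idfun)
    (g := (d k.+1 \o ctensor_map B (s' k.+1)) \+ (ctensor_map B (s' k) \o d k))).
exact: homology_iso (mapM _ _ _ fid) (mapM _ _ _ gid)
  (mapC _ _ _ _ _ s0 sS) (mapC _ _ _ _ _ t0 tS) n.
Qed.

End TensorOver.

(** * Representable functors *)

Section Representable.
Variables (C : category).

Definition repF (x : ob C) : functor C.
Proof.
refine (@Functor C (fun y => {freeg (hom x y)})
  (fun y z f => free_map (fun g : hom x y => compm f g)) _ _).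
- move=> y D; apply/eqP; rewrite -subr_eq0.
  pose h := free_map (fun g : hom x y => compm (idm y) g) \- idfun.
  apply: (free_ind (U := kerg h)) => g.
  by rewrite kergE /= free_liftE comp1m subrr.
- move=> y z t g f D; apply/eqP; rewrite -subr_eq0.
  pose h := free_map (fun k : hom x y => compm (compm g f) k) \-
    (free_map (fun k => compm g k) \o free_map (fun k => compm f k)).
  apply: (free_ind (U := kerg h)) => k.
  by rewrite kergE /= !free_liftE compmA subrr.
Defined.

Definition rep_gen (x y : ob C) (f : hom x y) : repF x y := << f >>.

Lemma rep_mapE (x y z : ob C) (g : hom y z) (f : hom x y) :
  fmap (repF x) g (rep_gen f) = rep_gen (compm g f).
Proof. exact: free_liftE. Qed.

Lemma rep_ext (x y : ob C) (G : zmodType) (f g : {additive repF x y -> G}) :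
  (forall k, f (rep_gen k) = g (rep_gen k)) -> f =1 g.
Proof.
move=> fg D; apply/eqP; rewrite -subr_eq0.
apply: (free_ind (U := kerg (f \- g))) => k.
by rewrite kergE subr_eq0 /= fg.
Qed.

Definition rep_lift (x y : ob C) (G : zmodType) (u : hom x y -> G) :
  {additive repF x y -> G} := free_lift u.

Lemma rep_liftE (x y : ob C) (G : zmodType) (u : hom x y -> G) f :
  rep_lift u (rep_gen f) = u f.
Proof. exact: free_liftE. Qed.

Section Yoneda.
Variables (F : functor C) (x : ob C) (a : F x).

Definition yonc (y : ob C) : {additive repF x y -> F y} :=
  rep_lift (fun f : hom x y => fmap F f a).

Lemma yoncE y (f : hom x y) : yonc y (rep_gen f) = fmap F f a.
Proof. exact: rep_liftE. Qed.

Lemma yoncN y z (f : hom y z) (D : repF x y) :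
  yonc z (fmap (repF x) f D) = fmap F f (yonc y D).
Proof.
apply: (rep_ext (f := yonc z \o fmap (repF x) f) (g := fmap F f \o yonc y)) => k.
by rewrite [LHS](congr1 (yonc z) (rep_mapE _ _)) /= !yoncE fmapM.
Qed.

Definition yon : nattrans (repF x) F := Nattrans yoncN.

Lemma yonE y (f : hom x y) : yon y (rep_gen f) = fmap F f a.
Proof. exact: yoncE. Qed.

End Yoneda.

Lemma nt_rep_ext (x : ob C) (F : functor C) (h k : nattrans (repF x) F) :
  h x (rep_gen (idm x)) = k x (rep_gen (idm x)) -> forall y a, h y a = k y a.
Proof.
move=> hk y; apply: rep_ext => f.
by rewrite -[f]compm1 -rep_mapE !ntN hk.
Qed.

(** By Yoneda, a lift amounts to one preimage of the image of the identity of [x]. *)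
Lemma rep_projective (x : ob C) : projective (repF x).
Proof.
move=> F G e p esurj; have [a aE] := esurj x (p x (rep_gen (idm x))).
exists (yon a); apply: (nt_rep_ext (h := nt_comp e (yon a))).
by rewrite /= yonE fmap1.
Qed.

Variable B : functor (op C).

Definition ct_rep_inv (x : ob C) (b : B x) : ctensor B (repF x) :=
  ct_pure b (rep_gen (idm x)).

Lemma ct_rep_inv_is_zmod_morphism x : zmod_morphism (@ct_rep_inv x).
Proof.
move=> b b'; apply/eqP; rewrite eq_sym subr_eq.
by rewrite /ct_rep_inv -ct_pureDl subrK.
Qed.

HB.instance Definition _ x := GRing.isZmodMorphism.Build (B x) (ctensor B (repF x))
  (@ct_rep_inv x) (@ct_rep_inv_is_zmod_morphism x).

(** Moving [f] across the tensor sign brings every generator to one over the identity; this is the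
    surjectivity in the co-Yoneda isomorphism. *)
Lemma ct_pure_rep (x y : ob C) (f : hom x y) (b : B y) :
  ct_pure b (rep_gen f) = ct_rep_inv (fmap B f b).
Proof. by rewrite /ct_rep_inv ct_wedge rep_mapE compm1. Qed.

Section Coyoneda.
Variable x : ob C.

Let ev y (b : B y) : {additive repF x y -> B x} :=
  rep_lift (fun f : hom x y => fmap B f b).

Let evE y (b : B y) (f : hom x y) : ev b (rep_gen f) = fmap B f b.
Proof. exact: rep_liftE. Qed.

Let evDl y (b b' : B y) D : ev (b + b') D = ev b D + ev b' D.
Proof.
apply: (rep_ext (f := ev (b + b')) (g := ev b \+ ev b')) => f.
by rewrite /= !evE raddfD.
Qed.

Let evDr y (b : B y) D D' : ev b (D + D') = ev b D + ev b D'.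
Proof. exact: raddfD. Qed.

Let evt y : {additive tensor (B y) (repF x y) -> B x} :=
  tensor_lift (@evDl y) (@evDr y).

Let evtE y (b : B y) D : evt y (pure b D) = ev b D.
Proof. exact: tensor_liftE. Qed.

Let evtW (y z : ob C) (f : hom y z) w :
  evt y (dmap (ext_tensor B (repF x)) f w) = evt z (codmap (ext_tensor B (repF x)) f w).
Proof.
pose d := dmap (ext_tensor B (repF x)) f.
pose c := codmap (ext_tensor B (repF x)) f.
have E b D : evt y (d (pure b D)) = evt z (c (pure b D)).
  have -> : d (pure b D) = pure (fmap B f b) (fmap (repF x) (idm y) D).
    exact: tensor_mapE.
  have -> : c (pure b D) = pure b (fmap (repF x) f D).
    by apply: etrans (tensor_mapE _ _ _ _) _; congr pure; apply: (@fmap1 _ B).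
  rewrite fmap1 !evtE.
  apply: (rep_ext (f := ev (fmap B f b)) (g := ev b \o fmap (repF x) f)) => k.
  rewrite evE [RHS](congr1 (ev b) (rep_mapE _ _)) evE.
  exact: esym (@fmapM _ B _ _ _ k f b).
exact: (tensor_ext (f := evt y \o d) (g := evt z \o c)).
Qed.

Definition ct_rep : {additive ctensor B (repF x) -> B x} := coend_lift evtW.

Lemma ct_repE y (b : B y) (f : hom x y) : ct_rep (ct_pure b (rep_gen f)) = fmap B f b.
Proof. by apply: etrans (coend_liftE _ _) _; rewrite evtE evE. Qed.

Lemma ct_rep_invK : cancel (@ct_rep_inv x) ct_rep.
Proof. by move=> b; rewrite ct_repE (@fmap1 _ B). Qed.

Lemma ct_repK : cancel ct_rep (@ct_rep_inv x).
Proof.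
pose i : {additive _ -> _} := @ct_rep_inv x.
have E y (b : B y) D : i (ct_rep (ct_pure b D)) = ct_pure b D.
  apply: (rep_ext (f := i \o ct_rep \o @ct_pure _ B (repF x) y b)
    (g := @ct_pure _ B (repF x) y b)) => f.
  by apply: etrans (congr1 i (ct_repE b f)) (esym (ct_pure_rep f b)).
exact: (ct_ext (f := i \o ct_rep) (g := idfun)).
Qed.

End Coyoneda.

End Representable.

(** * Arrows of the category of a monoid, extended by zero *)

Section Arrows.
Variable M : nmodType.
Implicit Types (x y z : M) (p : M * M).
Local Notation F x := (@repF (DM M) x).

(* 0 when p is not an arrow from x to y *)
Definition arr x y p : F x y :=
  oapp (fun f : dhom x y => @rep_gen (DM M) x y f) 0 (insub p).

Lemma arr_val x y (f : dhom x y) : arr x y (val f) = @rep_gen (DM M) x y f.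
Proof. by rewrite /arr valK. Qed.

Lemma arr_out x y p : p.1 + x + p.2 != y -> arr x y p = 0.
Proof. by move=> /negbTE pF; rewrite /arr insubF. Qed.

Lemma arr_act x y p q t z (e : q + y + t = z) : p.1 + x + p.2 = y ->
  fmap (F x) (exist _ (q, t) (introT eqP e) : dhom y z) (arr x y p) =
  arr x z (q + p.1, p.2 + t).
Proof.
move=> /eqP pxy; pose f : dhom x y := exist _ p pxy.
rewrite -[p]/(val f) arr_val rep_mapE; exact: esym (arr_val _).
Qed.

Lemma ct_arr (B : right_module M) x y u v (e : u + x + v = y) (b : B y) :
  @ct_pure _ B (F x) y b (arr x y (u, v)) = @ct_rep_inv _ B x (act B e b).
Proof.
pose f : dhom x y := exist _ (u, v) (introT eqP e).
by apply: etrans (congr1 (ct_pure b) (arr_val f)) _; rewrite ct_pure_rep.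
Qed.

End Arrows.

(** * The periodic resolution *)

(* For the cyclic monoid, N = m + q, w is the projection from the naturals and
   idx takes representatives below m + q. *)
Section CyclicResolution.
Variables (M : nmodType) (m N : nat) (w : nat -> M) (idx : M -> nat).
Hypotheses (mN : (m < N)%N) (w0 : w 0 = 0) (wD : {morph w : i j / (i + j)%N >-> i + j}).
Hypotheses (wN : w N = w m) (w_idx : cancel idx w) (idx_lt : forall x, (idx x < N)%N).
Hypothesis (idx_w : forall j, (j < N)%N -> idx (w j) = j).
Local Notation F x := (@repF (DM M) x).
Implicit Types (x y a b c : M).

(** The monomial a^i b^j. Exponents are arbitrary naturals, reduced only by [w], so that they can be
    shifted freely in telescoping sums. *)
Definition mono x y (i j : nat) : F x y := arr x y (w i, w j).

Lemma mono_periodl x y i j : mono x y (N + i) j = mono x y (m + i) j.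
Proof. by rewrite /mono wD wN -wD. Qed.

Lemma mono_periodr x y i j : mono x y i (N + j) = mono x y i (m + j).
Proof. by rewrite /mono wD wN -wD. Qed.

Lemma mono_out x y i j : w (i + j) + x != y -> mono x y i j = 0.
Proof. by move=> nxy; apply: arr_out; rewrite /= addrAC -wD. Qed.

Lemma mono_act x y z i j u v (f : dhom y z) :
  w (i + j) + x = y -> val f = (w u, w v) ->
  fmap (F x) f (mono x y i j) = mono x z (u + i) (j + v).
Proof.
case: f => -[p1 p2] /= e xy [ep1 ep2]; subst p1 p2.
rewrite (eq_irrelevance e (introT eqP (eqP e))) arr_act /=.
  by rewrite /mono !wD.
by rewrite addrAC -wD.
Qed.

Variant mono_spec x y i j : F x y -> Type :=
| MonoArrow (f : dhom x y) of val f = (w i, w j) & w (i + j) + x = y :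
    mono_spec i j (@rep_gen (DM M) x y f)
| MonoZero of w (i + j) + x != y : mono_spec i j 0.

Lemma monoP x y i j : mono_spec i j (mono x y i j).
Proof.
have [e|ne] := eqVneq (w (i + j) + x) y; last by rewrite mono_out //; right.
have e' : w i + x + w j == y by rewrite addrAC -wD e.
pose f : dhom x y := exist _ (w i, w j) e'.
by rewrite /mono -[(_, _)]/(val f) arr_val; left.
Qed.

(** The bound on [j] restricts the test to the basis 1, b, ..., b^(N-1), where the formulas for
    [sigma] and [tau] are valid. *)
Lemma mono_ext x y (G : zmodType) (f g : {additive F x y -> G}) :
  (forall i j, (j < N)%N -> w (i + j) + x = y -> f (mono x y i j) = g (mono x y i j)) ->
  f =1 g.
Proof.
move=> fg; apply: rep_ext => k.
case: k => -[u v] e; rewrite -arr_val /= -(w_idx u) -(w_idx v).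
apply: fg; first exact: idx_lt.
by rewrite wD !w_idx addrAC; apply/eqP.
Qed.

(* (b^n - a^n) / (b - a) times the monomial a^i b^j *)
Definition homog x y (n i j : nat) : F x y :=
  \sum_(t < n) mono x y (i + t) (n - t - 1 + j).

Lemma homog0 x y n i j : n = 0%N -> homog x y n i j = 0.
Proof. by move->; rewrite /homog big_ord0. Qed.

Lemma homog_out x y n i j : w (i + j + n.-1) + x != y -> homog x y n i j = 0.
Proof.
move=> nxy; apply: big1 => t _; apply: mono_out.
by have -> : (i + t + (n - t - 1 + j) = i + j + n.-1)%N by case: t => t /=; lia.
Qed.

(** Multiplying (b^n - a^n) / (b - a) by b - a gives back b^n - a^n. *)
Lemma homog_telescope x y n i j :
  homog x y n i j.+1 - homog x y n i.+1 j =
  mono x y i (n + j) - mono x y (i + n) j.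
Proof.
pose g t := mono x y (i + t) (n - t + j).
have gS t : (t < n)%N ->
    mono x y (i + t) (n - t - 1 + j.+1) - mono x y (i.+1 + t) (n - t - 1 + j) =
    - (g t.+1 - g t).
  by move=> tn; rewrite opprB /g; congr (mono _ _ _ _ - mono _ _ _ _); lia.
rewrite -sumrB (eq_bigr (fun t : 'I_n => - (g t.+1 - g t))) => [|t _]; last exact: gS.
rewrite sumrN -(big_mkord predT (fun t => g t.+1 - g t)) telescope_sumr // opprB.
by rewrite /g subn0 subnn add0n addn0.
Qed.

(** The term t = 0 is split off; the remaining ones share a factor a. *)
Lemma homogS0 x y n i : homog x y n.+1 i 0 = mono x y i n + homog x y n i.+1 0.
Proof.
rewrite /homog big_ord_recl /=; congr (mono _ _ _ _ + _); rewrite ?addn0 //; try lia.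
by apply: eq_bigr => t _; congr mono; rewrite /bump /=; lia.
Qed.

Definition S_elt a b : F a b := mono a b 0 1 - mono a b 1 0.

Definition T_elt a b : F a b :=
  \sum_(t < N) mono a b t (N - t - 1) - \sum_(t < m) mono a b t (m - t - 1).

(** By Yoneda an element of [F a b] is a map from [F b] to [F a], namely multiplication by that
    element. *)
Definition S_nt a b : nattrans (F b) (F a) := yon (S_elt a b).
Definition T_nt a b : nattrans (F b) (F a) := yon (T_elt a b).

Lemma S_ntE a b y i j : b = a + w 1 ->
  S_nt a b y (mono b y i j) = mono a y i j.+1 - mono a y i.+1 j.
Proof.
move=> ->; case: monoP => [f fE fV|nV].
  rewrite yonE raddfB /= !(mono_act _ fE) ?(addrC a) //.
  by rewrite addn0 addn1.
(* If the monomial is not an arrow from [b], neither monomial on the right is an arrow from [a], and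
   all three are 0. *)
by rewrite raddf0 !mono_out ?subrr // ?addnS ?addSn -[(_ + _).+1]addn1 wD
  -addrA (addrC _ a).
Qed.

Lemma S_nt_homog a b y n i j : b = a + w 1 ->
  S_nt a b y (homog b y n i j) = homog a y n i j.+1 - homog a y n i.+1 j.
Proof.
move=> ab; rewrite raddf_sum -sumrB; apply: eq_bigr => t _.
by rewrite S_ntE // addnS.
Qed.

(** The co-Yoneda isomorphism turns [S_nt] into the map S. The equations [el] and [eu] are left
    arbitrary so as to match those chosen in [Smap]. *)
Lemma ct_map_S (B : right_module M) a b (el : 0 + a + w 1 = b)
    (eu : w 1 + a + 0 = b) (v : B b) :
  ctensor_map B (S_nt a b) (@ct_rep_inv (DM M) B b v) =
  @ct_rep_inv (DM M) B a (act B el v - act B eu v).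
Proof.
by rewrite [RHS]raddfB [LHS]ct_mapE yonE fmap1 raddfB /mono w0; congr (_ - _);
  apply: ct_arr.
Qed.

Lemma ct_map_T (B : right_module M) a b
    (eN : forall t : 'I_N, w t + a + w (N - t - 1) = b)
    (em : forall t : 'I_m, w t + a + w (m - t - 1) = b) (v : B b) :
  ctensor_map B (T_nt a b) (@ct_rep_inv (DM M) B b v) =
  @ct_rep_inv (DM M) B a
    (\sum_(t < N) act B (eN t) v - \sum_(t < m) act B (em t) v).
Proof.
rewrite [RHS]raddfB [LHS]ct_mapE yonE fmap1 raddfB.
congr (_ - _); rewrite [LHS]raddf_sum [RHS]raddf_sum; apply: eq_bigr => t _.
  exact: ct_arr.
exact: ct_arr.
Qed.

(** The product of a^i b^j with (f(b) - f(a)) / (b - a), where f(t) = t^N - t^m. *)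
Definition Tpoly x y i j : F x y := homog x y N i j - homog x y m i j.

(** Multiplication by b - a yields f(b) - f(a), which vanishes since f(a) = f(b) = 0; hence a and b
    act alike on (f(b) - f(a)) / (b - a). *)
Lemma TpolyS x y i j : Tpoly x y i j.+1 = Tpoly x y i.+1 j.
Proof.
apply/eqP; rewrite -subr_eq0 /Tpoly opprD addrACA -opprD.
rewrite !homog_telescope mono_periodr (addnC i N) (addnC i m) mono_periodl.
by rewrite subrr.
Qed.

Lemma Tpoly0r x y i j : Tpoly x y i j = Tpoly x y (i + j) 0.
Proof.
by elim: j i => [|j IHj] i; rewrite ?addn0 // TpolyS IHj addSnnS.
Qed.

(** Defined at each [y] as a mere additive map, with [idx] choosing exponents below [N]. Exactness
    of a resolution is pointwise, so the contracting homotopy need not be natural. *)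
Definition sigma a b y : {additive F a y -> F b y} :=
  @rep_lift (DM M) a y _ (fun f : dhom a y => homog b y (idx (val f).2) (idx (val f).1) 0).

Definition tau a b y : {additive F a y -> F b y} :=
  @rep_lift (DM M) a y _ (fun f : dhom a y =>
    if idx (val f).2 == N.-1 then mono b y (idx (val f).1) 0 else 0).

Lemma sigmaE a b y i j : b = a + w 1 -> (j < N)%N ->
  sigma a b y (mono a y i j) = homog b y j i 0.
Proof.
move=> -> jN; case: monoP => [f fE fV|nV].
  apply: etrans (rep_liftE _ _) _; rewrite fE /= idx_w //.
  by apply: eq_bigr => t _; rewrite /mono !wD w_idx.
case: j jN nV => [|j] jN nV; first by rewrite raddf0 homog0.
by rewrite raddf0 homog_out // addn0 [_ + w 1]addrC addrA -wD addn1 -addnS.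
Qed.

(** * Consecutive differentials F d -> F c -> F b -> F a, given by S, T, S *)

Section Steps.
Variables a b c d : M.
Hypotheses (cE : b = a + w 1) (dE : c = a + w m) (eE : d = c + w 1).

Let N_gt0 : (0 < N)%N.
Proof. exact: leq_ltn_trans mN. Qed.

(** A sum [homog] of length n has degree n - 1. The cases used are n = [N] and, when [m] is
    positive, n = [m]: both sums in T go from [F c] to [F b]. *)
Let deg n : (0 < n)%N -> w n = w m -> w n.-1 + b = c.
Proof. by move=> n0 nm; rewrite cE dE -nm addrCA -wD addn1 prednK. Qed.

Lemma T_ntE y i j : T_nt b c y (mono c y i j) = Tpoly b y i j.
Proof.
case: monoP => [f fE fV|nV].
  rewrite yonE raddfB /= /Tpoly; congr (_ - _); rewrite raddf_sum;
    apply: eq_bigr => t _; rewrite (mono_act _ fE) //.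
    by rewrite -(deg N_gt0 wN); congr (w _ + _); case: t => t /=; lia.
  by case: t => t /= tm; rewrite -(@deg m) //; [congr (w _ + _); lia|lia].
rewrite raddf0 /Tpoly homog_out ?sub0r; last by rewrite wD -addrA deg.
(* For [m] = 0 the subtracted sum is empty and [deg] does not apply to it. *)
have [m0|m0] := posnP m; first by rewrite homog0 // oppr0.
by rewrite homog_out ?oppr0 // wD -addrA deg.
Qed.

Lemma S_T_eq0 y D : S_nt a b y (T_nt b c y D) = 0.
Proof.
pose s := S_nt a b y; pose t := T_nt b c y.
apply: (mono_ext (f := s \o t) (g := \0)) => i j _ _.
rewrite [LHS](congr1 s (T_ntE _ _ _)) [LHS]raddfB !S_nt_homog //.
rewrite !homog_telescope mono_periodr (addnC i N) (addnC i m) mono_periodl.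
by rewrite subrr.
Qed.

Lemma T_S_eq0 y D : T_nt b c y (S_nt c d y D) = 0.
Proof.
pose s := S_nt c d y; pose t := T_nt b c y.
apply: (mono_ext (f := t \o s) (g := \0)) => i j _ _.
rewrite [LHS](congr1 t (S_ntE _ _ _ eE)) [LHS]raddfB !T_ntE TpolyS.
by rewrite subrr.
Qed.

Lemma tauE y i j : (j < N)%N ->
  tau b c y (mono b y i j) = if j == N.-1 then mono c y i 0 else 0.
Proof.
move=> jN; case: monoP => [f fE fV|nV].
  apply: etrans (rep_liftE _ _) _; rewrite fE /= idx_w //.
  by case: ifP => // _; rewrite /mono w_idx.
rewrite raddf0; case: eqP => // jE; rewrite mono_out // addn0.
apply: contraNneq nV => <-; rewrite jE wD -addrA (deg N_gt0 wN) //.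
Qed.

(** S sigma is the identity minus the substitution of a for b. The latter is supplied by the
    augmentation in degree 0 and by tau T in positive even degrees. *)
Lemma S_sigma y i j : (j < N)%N ->
  S_nt a b y (sigma a b y (mono a y i j)) = mono a y i j - mono a y (i + j) 0.
Proof.
by move=> jN; rewrite sigmaE // S_nt_homog // homog_telescope addn0.
Qed.

(** Below the top exponent, [homogS0] gives sigma (b^(j+1) - a b^j) = b^j, and tau vanishes. *)
Lemma sigma_S_T_tau y D :
  sigma a b y (S_nt a b y D) + T_nt b c y (tau b c y D) = D.
Proof.
apply: (mono_ext (f := (sigma a b y \o S_nt a b y) \+ (T_nt b c y \o tau b c y))
  (g := idfun)) => i j jN _.
transitivity (sigma a b y (mono a y i j.+1) - sigma a b y (mono a y i.+1 j) +
    T_nt b c y (if j == N.-1 then mono c y i 0 else 0)).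
  by rewrite -raddfB -tauE // -(S_ntE _ _ _ cE).
rewrite (sigmaE _ _ cE jN); have [jE|jne] := eqVneq j N.-1; last first.
  have j1N : (j.+1 < N)%N by lia.
  by rewrite (sigmaE _ _ cE j1N) homogS0 addrK raddf0 addr0.
(* At the top exponent b^(j+1) = b^N becomes b^m before [sigma] sees it. The term T tau adds [homog]
   of length [N] and removes that of length [m], which repairs the formula. *)
have jN' : N = j.+1 by lia.
have -> : j.+1 = (N + 0)%N by lia.
rewrite mono_periodr addn0 (sigmaE _ _ cE mN) T_ntE.
by rewrite /Tpoly jN' homogS0 addrC addrA subrK addrK.
Qed.

End Steps.

(** Here tau T is the substitution of a for b, exactly what S sigma lacks: T (a^i b^j) depends only
    on i + j, and [tau] extracts its coefficient of b^(N-1). *)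
Lemma S_sigma_tau_T a b c d y D : b = a + w 1 -> c = a + w m -> d = c + w 1 ->
  S_nt c d y (sigma c d y D) + tau b c y (T_nt b c y D) = D.
Proof.
move=> bE cE dE.
apply: (mono_ext
  (f := (S_nt c d y \o sigma c d y) \+ (tau b c y \o T_nt b c y))
  (g := idfun)) => i j jN _.
have E := S_sigma dE y i jN. have E' := T_ntE bE cE y i j.
transitivity (mono c y i j - mono c y (i + j) 0 + tau b c y (Tpoly b y (i + j) 0)).
  by rewrite -Tpoly0r -E -E'.
suff -> : tau b c y (Tpoly b y (i + j) 0) = mono c y (i + j) 0 by rewrite subrK.
have N0 : (0 < N)%N by exact: leq_ltn_trans mN.
have tE u v : (v < N)%N -> tau b c y (mono b y u v) = if v == N.-1 then mono c y u 0 else 0.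
  exact: (tauE bE cE).
(* Only the term t = 0 has b-exponent N - 1. *)
have tauN : tau b c y (homog b y N (i + j) 0) = mono c y (i + j) 0.
  rewrite raddf_sum (bigD1 (Ordinal N0)) //= big1 => [|[t tN] /= t0].
    by rewrite !addn0 subn0 subn1 tE ?eqxx ?addr0 // prednK.
  have {}t0 : (0 < t)%N by rewrite lt0n; apply: contraNneq t0 => t0; apply/eqP/val_inj.
  by rewrite tE ?ifN_eq //; [apply/eqP|]; lia.
(* All b-exponents here are below [m], hence below N - 1. *)
have taum : tau b c y (homog b y m (i + j) 0) = 0.
  rewrite raddf_sum big1 // => -[t tm] _ /=.
  by rewrite tE ?ifN_eq //; [apply/eqP|]; lia.
by rewrite raddfB /= tauN taum subr0.
Qed.

Definition aug : nattrans (F 0) (constZ M) := @yon (DM M) (constZ M) 0 (1 : int).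

Lemma aug_mono y i j : w (i + j) = y -> aug y (mono 0 y i j) = 1.
Proof. by case: monoP => [f _ _ _|]; [rewrite yonE | rewrite addr0 => /eqP]. Qed.

Lemma aug_S a y D : a = w 1 -> aug y (S_nt 0 a y D) = 0.
Proof.
move=> aE; have aE' : a = 0 + w 1 by rewrite add0r.
apply: (mono_ext (f := aug y \o S_nt 0 a y) (g := \0)) => i j _ yE.
rewrite /= S_ntE // raddfB /= !aug_mono ?subrr //;
  by rewrite -yE aE -wD; congr w; lia.
Qed.

(** In [F 0 y] a monomial a^i b^j has i + j representing [y], so substituting a for b gives the
    power of a attached to [y]. Thus k -> k a^y is the section of [aug] that completes the
    homotopy. *)
Lemma S_sigma_aug a y D : a = w 1 ->
  S_nt 0 a y (sigma 0 a y D) + mono 0 y (idx y) 0 *~ (aug y D : int) = D.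
Proof.
move=> aE; have aE' : a = 0 + w 1 by rewrite add0r.
pose e (k : int) : F 0 y := mono 0 y (idx y) 0 *~ k.
have eB : zmod_morphism e by move=> k l; apply: mulrzBr.
pose E : {additive int -> F 0 y} := HB.pack e (GRing.isZmodMorphism.Build _ _ e eB).
apply: (mono_ext (f := (S_nt 0 a y \o sigma 0 a y) \+ (E \o aug y)) (g := idfun)).
move=> i j jN yE; have {}yE : w (i + j) = y by rewrite -yE addr0.
rewrite /= S_sigma // aug_mono //= /e mulr1z.
by rewrite /mono w_idx yE subrK.
Qed.

(** S shifts the object by 1 and the pair S, T by [m] in total; recording totals avoids a
    subtraction in the monoid. *)
Definition res_obj n : M := if odd n then w m *+ n./2 + w 1 else w m *+ n./2.

Lemma res_objS_even n : odd n = false -> res_obj n.+1 = res_obj n + w 1.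
Proof. by move=> on; rewrite /res_obj /= on uphalf_half on. Qed.

Lemma res_obj_odd n : odd n -> res_obj n = w m *+ n./2 + w 1.
Proof. by move=> on; rewrite /res_obj on. Qed.

Lemma res_objS_odd n : odd n -> res_obj n.+1 = w m *+ n./2 + w m.
Proof. by move=> on; rewrite /res_obj /= on uphalf_half on add1n mulrSr. Qed.

Definition res_nt n : nattrans (F (res_obj n.+1)) (F (res_obj n)) :=
  if odd n then T_nt _ _ else S_nt _ _.

Lemma res_nt_odd n : odd n -> res_nt n = T_nt (res_obj n) (res_obj n.+1).
Proof. by rewrite /res_nt => ->. Qed.

Lemma res_nt_even n : odd n = false -> res_nt n = S_nt (res_obj n) (res_obj n.+1).
Proof. by rewrite /res_nt => ->. Qed.

Lemma res_exact_aug y D : aug y D = 0 <-> exists D', res_nt 0 y D' = D.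
Proof.
have E : res_obj 1 = w 1 by rewrite /res_obj /= mulr0n add0r.
split=> [D0|[D' <-]]; last exact: aug_S.
by exists (sigma 0 (res_obj 1) y D); rewrite -[RHS](S_sigma_aug D E) D0 mulr0z addr0.
Qed.

(** The homotopy identities exhibit a cycle [D] as the boundary of [sigma] D for odd [n], and of
    [tau] D for even [n]. *)
Lemma res_exact n y D : res_nt n y D = 0 <-> exists D', res_nt n.+1 y D' = D.
Proof.
case: (boolP (odd n)) => [on|/negbTE on].
  have on1 : odd n.+1 = false by rewrite /= on.
  rewrite res_nt_odd // res_nt_even //.
  have bE := res_obj_odd on; have cE := res_objS_odd on.
  have dE : res_obj n.+2 = res_obj n.+1 + w 1 by apply: res_objS_even.
  split=> [D0|[D' <-]]; last exact: T_S_eq0 bE cE dE y D'.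
  exists (sigma (res_obj n.+1) (res_obj n.+2) y D).
  by rewrite -[RHS](S_sigma_tau_T D bE cE dE) D0 raddf0 addr0.
have on1 : odd n.+1 by rewrite /= on.
rewrite res_nt_even // res_nt_odd //; have bE := res_objS_even on.
have cE : res_obj n.+2 = res_obj n + w m.
  by rewrite res_objS_odd //= uphalf_half on /res_obj on.
split=> [D0|[D' <-]]; last exact: S_T_eq0 bE cE y D'.
exists (tau (res_obj n.+1) (res_obj n.+2) y D).
by rewrite -[RHS](sigma_S_T_tau bE cE D) D0 raddf0 add0r.
Qed.

Lemma aug_surj y k : aug y (mono 0 y (idx y) 0 *~ k) = k.
Proof. by rewrite raddfMz /= aug_mono ?addn0 ?w_idx // intz. Qed.

Definition periodic_resolution : resolution (constZ M) :=
  @Resolution (DM M) (constZ M) (fun n => F (res_obj n)) res_nt aug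
    (fun n => @rep_projective (DM M) (res_obj n))
    (fun y k => ex_intro _ (mono 0 y (idx y) 0 *~ k) (aug_surj y k))
    res_exact_aug res_exact.

End CyclicResolution.

(** * Homology of cyclic monoids *)

Section Transfer.
Variables (C : category) (B : functor (op C)).
Local Notation phi x := (@ct_rep_inv C B x).

Lemma ct_rep_inv_inj x : injective (phi x).
Proof. exact: can_inj (@ct_rep_invK C B x). Qed.

Lemma ct_rep_inv_eq0 x b : (phi x b == 0) = (b == 0).
Proof. by rewrite -[X in _ == X](raddf0 (phi x)) (inj_eq (@ct_rep_inv_inj x)). Qed.

Section Square.
Variables (x y : ob C) (d : {additive ctensor B (repF y) -> ctensor B (repF x)}).
Variable delta : {additive B y -> B x}.
Hypothesis dE : forall b, d (phi y b) = phi x (delta b).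

Lemma mem_kerg_rep b : (phi y b \in kerg d) = (b \in kerg delta).
Proof. by rewrite !kergE dE ct_rep_inv_eq0. Qed.

Lemma mem_img_rep b : (phi x b \in img d) = (b \in img delta).
Proof.
apply/imgP/imgP => [[u uE]|[u <-]]; last by exists (phi y u).
exists (@ct_rep C B y u); apply: ct_rep_inv_inj.
by rewrite -dE [phi y _]ct_repK.
Qed.

End Square.

Lemma subquot_rep_iso (x : ob C) (Z I : zmodClosed (ctensor B (repF x)))
    (Z' I' : zmodClosed (B x)) :
  (forall b, (phi x b \in Z) = (b \in Z')) ->
  (forall b, (phi x b \in I) = (b \in I')) ->
  isomorphic (subquot Z I) (subquot Z' I').
Proof.
move=> eZ eI; apply: (subquot_iso (f := @ct_rep C B x) (g := phi x)) => v.
- by rewrite -eZ [phi x _]ct_repK.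
- by rewrite eZ.
- by rewrite -eI [phi x _]ct_repK.
- by rewrite eI.
- by rewrite [X in X - _]ct_repK subrr rpred0.
- by rewrite ct_rep_invK subrr rpred0.
Qed.

(** For degree 0: homology is a quotient of the subtype of all elements, while the target is a plain
    quotient. The map [s] re-enters that subtype. *)
Lemma quot_rep_iso (x : ob C) (I : zmodClosed (ctensor B (repF x)))
    (I' : zmodClosed (B x)) :
  (forall b, (phi x b \in I) = (b \in I')) ->
  isomorphic (subquot (@allg _) I) (Quotient.quot I').
Proof.
move=> eI; pose sub u := Subg (isT : u \in @allg (ctensor B (repF x))).
have subB : zmod_morphism sub by move=> u v; apply: val_inj.
pose s : {additive _ -> _} := HB.pack sub (GRing.isZmodMorphism.Build _ _ sub subB).
apply: (quot_iso (f := @ct_rep C B x \o val) (g := s \o phi x)) => v.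
- by rewrite preimgE -eI [phi x _]ct_repK.
- by rewrite preimgE -eI.
- have e : val ((s \o phi x) ((@ct_rep C B x \o val) v)) = val v by apply: ct_repK.
  by rewrite preimgE raddfB [X in X - _]e subrr rpred0.
- by rewrite [X in X - _]ct_rep_invK subrr rpred0.
Qed.

End Transfer.

Section CyclicHomology.
Variables (m q : nat) (hq : (0 < q)%N).
Local Notation C := (cyclic m hq).
Local Notation w := (@wp m q hq).
Variable B : right_module C.
Local Notation phi x := (@ct_rep_inv (DM C) B x).
Local Notation Snt := (@S_nt C w).
Local Notation Tnt := (@T_nt C m (m + q) w).

Lemma ct_map_Smap (x : C) (b : B (x + w 1)) :
  ctensor_map B (Snt x (x + w 1)) (phi (x + w 1) b) = phi x (Smap b).
Proof. by rewrite (ct_map_S erefl (S_lower_eq x) (S_upper_eq x)). Qed.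

Lemma ct_map_Tmap (x : C) (hx : (0 < x)%N) (b : B (w m + cpred x)) :
  ctensor_map B (Tnt x (w m + cpred x)) (phi (w m + cpred x) b) = phi x (Tmap hx b).
Proof. by rewrite (ct_map_T (T_eq_mq hx) (T_eq_m hx)). Qed.

Lemma iso_S_T (x a b c : C) (hx : (0 < (x + w 1)%R)%N) :
  a = x -> b = x + w 1 -> c = w m + cpred (x + w 1) ->
  isomorphic
    (subquot (kerg (ctensor_map B (Snt a b))) (img (ctensor_map B (Tnt b c))))
    (subquot (kerS B x) (imT B hx)).
Proof.
move=> -> -> ->; apply: subquot_rep_iso => v.
  exact: (mem_kerg_rep (@ct_map_Smap x)).
exact: (mem_img_rep (@ct_map_Tmap _ hx)).
Qed.

Lemma iso_T_S (x z a b c : C) (hx : (0 < x)%N) (e : z = w m + cpred x) :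
  a = x -> b = z -> c = z + w 1 ->
  isomorphic
    (subquot (kerg (ctensor_map B (Tnt a b))) (img (ctensor_map B (Snt b c))))
    (subquot (kerT B hx) (transport_subg (V := B) e (imS B z))).
Proof.
move=> -> -> ->.
(* The transport disappears only when its equation can be eliminated. So its endpoint becomes a
   variable [t], and the kernel of T an arbitrary [K] known by its members. *)
have gen t (e' : z = t) (K : zmodClosed (B t)) :
    (forall v, (phi t v \in kerg (ctensor_map B (Tnt x t))) = (v \in K)) ->
    isomorphic
      (subquot (kerg (ctensor_map B (Tnt x z))) (img (ctensor_map B (Snt z (z + w 1)))))
      (subquot K (transport_subg (V := B) e' (imS B z))).
  case: _ / e' K => K KE; apply: subquot_rep_iso => v; first exact: KE.
  exact: (mem_img_rep (@ct_map_Smap z)).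
by apply: gen => v; apply: (mem_kerg_rep (@ct_map_Tmap _ hx)).
Qed.

Lemma iso_S0 (a b : C) : a = 0 -> b = w 1 ->
  isomorphic (subquot (@allg _) (img (ctensor_map B (Snt a b))))
    (Quotient.quot (imS B 0)).
Proof.
move=> -> bE; have {bE} -> : b = 0 + w 1 by rewrite add0r.
by apply: quot_rep_iso => v; apply: (mem_img_rep (@ct_map_Smap 0)).
Qed.

Lemma wpN : w (m + q) = w m.
Proof. exact: wp_period. Qed.

Lemma ltn_mN : (m < m + q)%N.
Proof. by rewrite -[X in (X < _)%N]addn0 ltn_add2l. Qed.

Definition cyclic_resolution : resolution (constZ C) :=
  periodic_resolution (M := C) (m := m) (N := (m + q)%N) (w := w)
    (idx := fun x : C => x : nat) ltn_mN (@wpD m q hq) wpN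
    (@wp_val m q hq) (fun x : C => ltn_ord x) (fun j => @wpn_small m q j).

End CyclicHomology.

Theorem theorem5p2 (m q : nat) (hq : (1 <= q)%N) (hmq : (2 <= m + q)%N)
    (B : right_module (cyclic m hq)) :
  isomorphic (leech_homology 0 B) (Quotient.quot (imS B 0)) /\
  forall r : nat,
    isomorphic (leech_homology (2 * r + 1) B)
      (subquot (kerS B (wp hq m *+ r)) (imT B (mulm_succ_gt0 hq r hmq))) /\
    isomorphic (leech_homology (2 * r + 2) B)
      (subquot (kerT B (mulm_succ_gt0 hq r hmq))
         (transport_subg (V := B) (mulm_succ_pred hq r) (imS B (wp hq m *+ r.+1)))).
Proof.
pose P := cyclic_resolution m hq.
(* Leech homology is computed by the standard resolution; the comparison theorem replaces it with
   the periodic one. *)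
have reduce n V : isomorphic (tensor_homology B P n) V -> isomorphic (leech_homology n B) V.
  by apply: isomorphic_trans; apply: tensor_homology_iso.
pose w := @wp m q hq.
split=> [|r]; first by apply: reduce; apply: iso_S0; rewrite /res_obj /= ?mulr0n ?add0r.
have o2 : odd (2 * r) = false by rewrite oddM.
have o2S : odd (2 * r).+1 by rewrite /= o2.
have o2SS : odd (2 * r).+2 = false by rewrite /= o2.
have h2 : (2 * r)./2 = r by rewrite mul2n doubleK.
have E0 : res_obj m w (2 * r) = w m *+ r by rewrite /res_obj o2 h2.
have E1 : res_obj m w (2 * r).+1 = w m *+ r + w 1 by rewrite res_objS_even ?E0.
have E2 : res_obj m w (2 * r).+2 = w m *+ r.+1.
  by rewrite /res_obj o2SS /= h2.
have E3 : res_obj m w (2 * r).+3 = w m *+ r.+1 + w 1 by rewrite res_objS_even ?E2.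
split; apply: reduce.
  rewrite addn1.
  (* With the degree written as a successor, [cycles] computes to the kernel of the preceding
     differential. *)
  change (isomorphic
    (subquot (kerg (ctensor_map B (res_nt m (m + q) w (2 * r))))
       (img (ctensor_map B (res_nt m (m + q) w (2 * r).+1))))
    (subquot (kerS B (w m *+ r)) (imT B (mulm_succ_gt0 hq r hmq)))).
  rewrite res_nt_even // res_nt_odd //; apply: iso_S_T => //.
  by rewrite E2 (mulm_succ_pred hq).
rewrite addn2.
change (isomorphic
  (subquot (kerg (ctensor_map B (res_nt m (m + q) w (2 * r).+1)))
     (img (ctensor_map B (res_nt m (m + q) w (2 * r).+2))))
  (subquot (kerT B (mulm_succ_gt0 hq r hmq))
     (transport_subg (V := B) (mulm_succ_pred hq r) (imS B (w m *+ r.+1))))).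
by rewrite res_nt_odd // res_nt_even //; apply: iso_T_S.
Qed.
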